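(* (1) Let $1\le\ell_1\le\dots\le\ell_r\le n$ and $T=C_r\otimes\cdots\otimes C_1$ with $C_i\in B(\varpi_{\ell_i})$. Then $\widetilde\psi_T=\prod_{i=1}^{r-1}\widetilde\psi_{C_{i+1}\otimes C_i}$. (2) Let $1\le a\le b\le n$, $F\in B(\varpi_b)$, $E\in B(\varpi_a)$. Then: (a) if $F\otimes E$ is not semistandard, $\widetilde\psi_{F\otimes E}=0$; (b) if $E=(1,\dots,a)$ and $F\otimes E$ is semistandard, $\widetilde\psi_{F\otimes E}=1$; (c) if $F\otimes E$ is semistandard and $j\in[n-1]$ with $s_jE\le E$, then $$\widetilde\psi_{F\otimes E}=\begin{cases}t\,\widetilde\psi_{s_jF\otimes s_jE}+(1-t)\,\widetilde\psi_{F\otimes s_jE}, & \text{if } s_jF\ge F,\\ \widetilde\psi_{s_jF\otimes s_jE}, & \text{if } s_jF\le F.\end{cases}$$ In particular every $\widetilde\psi_T$ lies in $\mathbb Z[t]$.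
   Context: Fix $n\ge1$, $[n]=\{1,\dots,n\}$. $S_n$ is the symmetric group with simple transpositions $s_i=(i,i+1)$ and length function $\ell(\cdot)$; it acts on $\mathbb Z^n$ by permuting coordinates; $\varpi_k=\varepsilon_1+\dots+\varepsilon_k$ ($\varepsilon_i$ standard basis). For $\lambda\in\mathbb Z^n$, $S_{n,\lambda}=\{w:w\lambda=\lambda\}$ and $W_\lambda(t)=\sum_{w\in S_{n,\lambda}}t^{\ell(w)}$. The affine Hecke algebra $H$ is the $\mathbb Z[t^{\pm1}]$-algebra with generators $T_1,\dots,T_{n-1},X_1^{\pm1},\dots,X_n^{\pm1}$ and relations $T_i^2=(t-1)T_i+t$, $T_iT_{i+1}T_i=T_{i+1}T_iT_{i+1}$, $T_iT_j=T_jT_i$ ($|i-j|>1$), $X_iX_j=X_jX_i$, $T_iX_iT_i=tX_{i+1}$, $T_iX_j=X_jT_i$ ($j\notin\{i,i+1\}$). $T_w=T_{i_1}\cdots T_{i_m}$ for a reduced word of $w$. $H_n$ is the subalgebra generated by the $T_i$ (basis $\{T_w\}$); $H_{n,\lambda}$ is the span of $\{T_w:w\in S_{n,\lambda}\}$; $\mathbf 1_\lambda=\sum_{w\in S_{n,\lambda}}T_w$. Columns: a column of length $\ell$ is $C=(c_1<\dots<c_\ell)\subseteq[n]$; $B(\varpi_\ell)$ is their set; partial order $E\le F$ iff $e_i\le f_i$ for all $i$. $u_C\in S_n$ sends $k\mapsto c_k$ ($k\le\ell$) and sends $\ell+1,\dots,n$ increasingly onto $[n]\setminus C$. $s_jC$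 is the column whose underlying set is the image of $C$ under the transposition $(j,j+1)$. Tensors $T=C_r\otimes\cdots\otimes C_1$ ($C_i\in B(\varpi_{\ell_i})$, $\ell_1\le\dots\le\ell_r$) are fillings of the Young diagram of $\lambda=\sum\varpi_{\ell_i}$ with columns $C_r,\dots,C_1$ left to right; semistandard means rows weakly increase left to right. Definition of $\Psi$: every $h\in H_n$ is uniquely $\sum_{F\in B(\varpi_\ell)}T_{u_F}h_F$ with $h_F\in H_{n,\varpi_\ell}$. For a column $C\in B(\varpi_\ell)$, $\Psi_C=t^{\ell(u_C)}(T_{u_C^{-1}})^{-1}\mathbf 1_{\varpi_\ell}$; for $T=C\otimes S$, $C\in B(\varpi_\ell)$, $S$ a tensor of columns of lengths $\le\ell$, write $\Psi_S=\sum_{E\in B(\varpi_\ell)}T_{u_E}h_{E,S}$ ($h_{E,S}\in H_{n,\varpi_\ell}$) and set $\Psi_T=t^{\ell(u_C)}(T_{u_C^{-1}})^{-1}h_{C,S}$. Definition of $\widetilde\psi$: for $T$ of shape $\lambda$ with $\Psi_T=\sum_{w\in S_n}a_wT_w$ ($a_w\in\mathbb Z[t^{\pm1}]$), $\widetilde\psi_T=W_\lambda(t)^{-1}\sum_w a_wt^{\ell(w)}\in\mathbb Q(t)$; equivalently $\widetilde\psi_T\mathbf 1_0=W_\lambda(t)^{-1}\Psi_T\mathbf 1_0$ where $\mathbf 1_0=\sum_{w\in S_n}T_w$. *)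

(* Defs.v *)
From HB Require Import structures.
From mathcomp Require Import all_boot all_order all_fingroup all_algebra.
From Stdlib Require Import ClassicalEpsilon.

Set Implicit Arguments.
Unset Strict Implicit.
Unset Printing Implicit Defensive.

Import GRing.Theory.
Local Open Scope ring_scope.

(* Coefficients: Q(t) = fraction field of Q[t].  The Hecke algebra,    *)
(* defined over Z[t^{+-1}] in the paper, is taken with scalars extended *)
(* to Q(t) (a faithful extension: H_n is free with basis T_w).          *)
Definition K : fieldType := {fraction {poly rat}}.
Definition tt : K := FracField.tofrac ('X : {poly rat}).

Definition in_Zt (x : K) : Prop :=
  exists p : {poly int}, x = FracField.tofrac (map_poly (fun z : int => z%:~R : rat) p).

(* Positions [n] = {1..n} are encoded as 'I_n = {0..n-1}. *)
Section Hecke.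
Variable n : nat.

Definition len (w : 'S_n) : nat :=
  #|[set p : 'I_n * 'I_n | (p.1 < p.2)%N && (w p.2 < w p.1)%N]|.

(* Usual composition (v o w)(x) = v (w x); note MathComp's (w * v) x = v (w x). *)
Definition comp (v w : 'S_n) : 'S_n := (w * v)%g.

(* The Hecke algebra H_n, as the free Q(t)-module with basis (T_w)_{w in S_n}. *)
Local Notation hecke := {ffun 'S_n -> K}.
Definition hsc (a : K) (h : hecke) : hecke := [ffun w => a * h w].

Definition T_ (w : 'S_n) : hecke := [ffun v => (v == w)%:R].
Definition hone : hecke := T_ 1%g.

(* Right multiplication by T_s, s = (i, j) with j = i+1 (a simple transposition):
   T_w T_s = T_{ws} if len(ws) > len(w), and (t-1) T_w + t T_{ws} otherwise
   (consequence of T_s^2 = (t-1)T_s + t and the braid relations). *)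
Definition rmul_s (i j : 'I_n) (h : hecke) : hecke :=
  \sum_(w : 'S_n) hsc (h w)
     (if (len w < len (comp w (tperm i j)))%N then T_ (comp w (tperm i j))
      else hsc (tt - 1) (T_ w) + hsc tt (T_ (comp w (tperm i j)))).

(* h * T_v, computed along a reduced word of v (picking a right descent). *)
Fixpoint rmulw_fuel (k : nat) (v : 'S_n) (h : hecke) : hecke :=
  match k with
  | 0 => h
  | k'.+1 =>
    match [pick p : 'I_n * 'I_n | (val p.2 == (val p.1).+1) && (v p.2 < v p.1)%N] with
    | None => h
    | Some p => rmul_s p.1 p.2 (rmulw_fuel k' (comp v (tperm p.1 p.2)) h)
    end
  end.
Definition rmulw (v : 'S_n) (h : hecke) : hecke := rmulw_fuel (len v) v h.

Definition hmul (h g : hecke) : hecke := \sum_(v : 'S_n) hsc (g v) (rmulw v h).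

Definition hinv (h : hecke) : hecke :=
  epsilon (inhabits (0 : hecke)) (fun g => hmul h g = hone /\ hmul g h = hone).

Definition stab (lam : 'I_n -> nat) (w : 'S_n) : bool :=
  [forall k : 'I_n, lam (w k) == lam k].

Definition varpi (l : nat) (k : 'I_n) : nat := (k < l)%N.

Definition inHpar (l : nat) (h : hecke) : Prop :=
  forall w, h w != 0 -> stab (varpi l) w.

Definition one_par (l : nat) : hecke := \sum_(w | stab (varpi l) w) T_ w.

(* Columns: subsets C of [n]; their increasing enumeration c_1 < ... < c_l. *)
Definition col_nat (C : {set 'I_n}) : seq nat := sort leq [seq val x | x <- enum C].
Definition col_ord (C : {set 'I_n}) : seq 'I_n :=
  sort (fun x y : 'I_n => (x <= y)%N) (enum C).

Definition useq (C : {set 'I_n}) : seq 'I_n := col_ord C ++ col_ord (~: C).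
Definition u_ (C : {set 'I_n}) : 'S_n :=
  odflt 1%g [pick w : 'S_n | [forall k : 'I_n, w k == nth k (useq C) k]].

Definition col_le (E F : {set 'I_n}) : Prop :=
  #|E| = #|F| /\ forall k, (k < #|E|)%N -> (nth 0 (col_nat E) k <= nth 0 (col_nat F) k)%N.

(* s_j C, for the simple transposition s_j = (i, j), j = i+1. *)
Definition sact (i j : 'I_n) (C : {set 'I_n}) : {set 'I_n} := tperm i j @: C.

(* F (x) E semistandard (F left column, E right column, #|E| <= #|F|). *)
Definition ss2 (F E : {set 'I_n}) : Prop :=
  forall k, (k < #|E|)%N -> (nth 0 (col_nat F) k <= nth 0 (col_nat E) k)%N.

(* Unique decomposition h = sum_{F in B(varpi_l)} T_{u_F} h_F with h_F in H_{n,varpi_l}. *)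
Definition is_decomp (l : nat) (h : hecke) (d : {ffun {set 'I_n} -> hecke}) : Prop :=
  [/\ forall F : {set 'I_n}, #|F| <> l -> d F = 0,
      forall F : {set 'I_n}, inHpar l (d F) &
      h = \sum_(F : {set 'I_n} | #|F| == l) hmul (T_ (u_ F)) (d F)].
Definition decomp (l : nat) (h : hecke) : {ffun {set 'I_n} -> hecke} :=
  epsilon (inhabits [ffun _ => 0]) (is_decomp l h).

(* Tensors T = C_r (x) ... (x) C_1 are lists [:: C_r; ...; C_1] (left to right). *)
Definition PsiCol (C : {set 'I_n}) : hecke :=
  hsc (tt ^+ len (u_ C)) (hmul (hinv (T_ (u_ C)^-1)) (one_par #|C|)).

Fixpoint Psi (T : seq {set 'I_n}) : hecke :=
  match T with
  | [::] => hone (* unused: tensors are nonempty *)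
  | C :: S0 =>
    if S0 is [::] then PsiCol C
    else hsc (tt ^+ len (u_ C)) (hmul (hinv (T_ (u_ C)^-1)) (decomp #|C| (Psi S0) C))
  end.

(* Shape lambda = sum_i varpi_{l_i}: lambda_k = #{i | l_i >= k}. *)
Definition shape (T : seq {set 'I_n}) (k : 'I_n) : nat := count (fun C : {set 'I_n} => (k < #|C|)%N) T.

Definition Wpoly (lam : 'I_n -> nat) : K := \sum_(w | stab lam w) tt ^+ len w.

Definition psit (T : seq {set 'I_n}) : K :=
  (Wpoly (shape T))^-1 * \sum_(w : 'S_n) Psi T w * tt ^+ len w.

Definition tensor_ok (T : seq {set 'I_n}) : Prop :=
  [/\ T <> [::], all (fun C : {set 'I_n} => (0 < #|C|)%N) T & sorted geq [seq #|C| | C : {set 'I_n} <- T]].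

End Hecke.

(* Main.v *)
(* With chi the trivial character T_w |-> t^len(w), and h = sum_F T_{u_F} h_F,
   one has chi(Psi_{C (x) S}) = chi(h_C) for h = Psi_S, because
   t^len(u) (T_{u^-1})^-1 has character 1.  Write gam_F(h) = chi(h_F).

   Two columns: if s_j E <= E then Psi_E = (T_j - (t - 1)) Psi_{s_j E}, and the
   action of T_j on the functionals gam_F is that of H_n on the induced module
   with basis the columns; this is recursion (c), valid for all F, E.  Part (a)
   follows by descending to E = (1..a), where Psi_E = 1_{varpi_a} can be decomposed
   explicitly; semistandardness is tracked by the counts #{x in C | x < m}.

   Factorization: let T = C (x) D (x) S with l = #|D|.  Then
   Psi_{D (x) S} = x g with g in H_{varpi_l} and g T_s = t g for s acting beyond l.
   Computing gam_C(x g 1_{varpi_l}) in two ways gives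
   W_{varpi_l} gam_C(x g) = chi(g) gam_C(x 1_{varpi_l}), and the Poincare
   polynomials match since the stabilizers split at l.

   Associativity of the product on {ffun 'S_n -> K} comes from left multiplication
   operators that commute with the right ones and generate everything from 1. *)
Require Import Defs.
From HB Require Import structures.
From mathcomp Require Import all_boot all_order all_fingroup all_algebra.
From mathcomp Require Import ring zify.
From Stdlib Require Import ClassicalEpsilon.
Import Order.TTheory GRing.Theory.
Local Open Scope ring_scope.

Local Notation comp := Defs.comp.
Local Notation shape := Defs.shape.

(** * Permutations: inversions, descents and induction on length *)

Section SymmetricGroup.
Variable n : nat.
Implicit Types (w v y : 'S_n) (i j k m : 'I_n).

Lemma compE v w k : comp v w k = v (w k).
Proof. by rewrite /comp permM. Qed.

Lemma compA v w y : comp v (comp w y) = comp (comp v w) y.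
Proof. by rewrite /comp mulgA. Qed.

Lemma comp1 v : comp v 1%g = v.
Proof. by rewrite /comp mul1g. Qed.

Lemma compK i j w : comp (comp w (tperm i j)) (tperm i j) = w.
Proof. by rewrite /comp mulgA tperm2 mul1g. Qed.

Lemma compKl i j w : comp (tperm i j) (comp (tperm i j) w) = w.
Proof. by rewrite /comp -mulgA tperm2 mulg1. Qed.

Lemma comp_inv v w : (comp v w)^-1%g = comp w^-1%g v^-1%g.
Proof. by rewrite /comp invMg. Qed.

Lemma tperm_adj_mono i j k m : j = i.+1 :> nat -> ~ (k = i /\ m = j) ->
  (k < m)%N -> (tperm i j k < tperm i j m)%N.
Proof.
move=> hij hn hkm.
have nv (x y : 'I_n) : x <> y -> x <> y :> nat by move=> h /val_inj.
case: tpermP => [ek|ek|/nv e1 /nv e2]; case: tpermP => [em|em|/nv f1 /nv f2];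
  rewrite ?ek ?em in hn hkm *; try lia.
by case: hn.
Qed.

Lemma tperm_adj_ltn i j k m : j = i.+1 :> nat ->
  ~ (k = i /\ m = j) -> ~ (k = j /\ m = i) ->
  (tperm i j k < tperm i j m)%N = (k < m)%N.
Proof.
move=> hij h1 h2; case: (ltngtP k m) => h.
- exact: tperm_adj_mono.
- apply/negbTE; rewrite -leqNgt ltnW //.
  by apply: tperm_adj_mono => // -[a b]; apply: h2.
- by rewrite (val_inj h) ltnn.
Qed.

(** Applying the transposition to both entries of a pair carries the inversions of [w] onto those of
    the product other than [(i, j)], which is the one new inversion. *)
Lemma len_asc w i j : j = i.+1 :> nat -> (w i < w j)%N ->
  len (comp w (tperm i j)) = (len w).+1.
Proof.
move=> hij hw; rewrite /len.
set A := [set p | _]; set B := [set p | _].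
pose f (p : 'I_n * 'I_n) := (tperm i j p.1, tperm i j p.2).
have fK : involutive f by case=> a b; rewrite /f /= !tpermK.
have ij : (i < j)%N by rewrite hij.
have -> : A = (i, j) |: (f @: B).
  apply/setP=> -[a b]; rewrite in_setU1 inE /= !compE.
  have -> : ((a, b) \in f @: B) = (f (a, b) \in B).
    by rewrite -{1}(fK (a, b)) (mem_imset _ _ (inv_inj fK)).
  rewrite xpair_eqE inE /=.
  case: (boolP ((a == i) && (b == j))) => [/andP[/eqP-> /eqP->]|ne] /=.
    by rewrite ij tpermL tpermR.
  case: (boolP ((a == j) && (b == i))) => [/andP[/eqP-> /eqP->]|ne2].
    rewrite tpermL tpermR ij (ltnNge j i) (ltnW ij) /=.
    by rewrite (ltnNge (w j)) (ltnW hw).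
  rewrite tperm_adj_ltn // => -[? ?]; subst.
    by rewrite !eqxx in ne.
  by rewrite !eqxx in ne2.
rewrite cardsU1 card_imset; last exact: inv_inj.
have -> : ((i, j) \in f @: B) = (f (i, j) \in B).
  by rewrite -{1}(fK (i, j)) (mem_imset _ _ (inv_inj fK)).
rewrite inE /= tpermL tpermR.
by rewrite (ltnNge j i) (ltnW ij).
Qed.

Lemma len_desc w i j : j = i.+1 :> nat -> (w j < w i)%N ->
  len w = (len (comp w (tperm i j))).+1.
Proof.
move=> hij hw; rewrite -{1}(compK i j w); apply: len_asc => //.
by rewrite !compE tpermL tpermR.
Qed.

Lemma perm_adj_neq w i j : j = i.+1 :> nat -> (w i == w j :> nat) = false.
Proof.
move=> h; apply/negbTE/eqP => /val_inj /perm_inj e.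
by move: h; rewrite e; lia.
Qed.

Lemma len_lt w i j : j = i.+1 :> nat ->
  (len w < len (comp w (tperm i j)))%N = (w i < w j)%N.
Proof.
move=> hij; case: (ltngtP (w i) (w j)) => h.
- by rewrite len_asc // ltnSn.
- by rewrite (len_desc _ _ _ hij h) ltnNge leqnSn.
- by move/eqP: h; rewrite perm_adj_neq.
Qed.

Lemma len1 : len (1%g : 'S_n) = 0.
Proof.
apply/eqP; rewrite cards_eq0; apply/eqP/setP=> -[a b]; rewrite !inE /= !perm1.
by case: ltngtP.
Qed.

Lemma len_inv w : len w^-1%g = len w.
Proof.
rewrite /len.
set A := [set p | _]; set B := [set p | _].
pose f (p : 'I_n * 'I_n) := (w p.2, w p.1).
have fI : injective f by case=> a b [c d] [/perm_inj -> /perm_inj ->].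
have -> : A = f @: B.
  apply/setP=> -[a b].
  have -> : (a, b) = f (w^-1%g b, w^-1%g a) by rewrite /f /= !permKV.
  by rewrite (mem_imset _ _ fI) !inE /= !permK andbC.
by rewrite card_imset.
Qed.

Lemma asc_mono w : (forall i j, j = i.+1 :> nat -> (w i < w j)%N) ->
  forall k m, (k < m)%N -> (w k < w m)%N.
Proof.
move=> h k m.
have [d] := ubnP (m - k)%N; elim: d m => // d IH m hd km.
have hm : (m.-1 < n)%N by have := ltn_ord m; lia.
pose m' := Ordinal hm.
have mm : m = m'.+1 :> nat by rewrite /=; lia.
have h2 := h _ _ mm.
case: (eqVneq (k : nat) m') => [e|ne].
  by have -> : k = m' by apply: val_inj.
apply: ltn_trans h2; apply: IH; move: ne => /=; lia.
Qed.

Lemma mono_ge w : (forall k m, (k < m)%N -> (w k < w m)%N) -> forall k, (k <= w k)%N.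
Proof.
move=> h [k hk] /=; elim: k hk => // k IH hk.
have hk' : (k < n)%N by lia.
by apply: leq_ltn_trans (IH hk') _; apply: h => /=.
Qed.

(** Both [w] and its inverse are increasing, so neither lowers any position; hence [w] fixes all of
    them. *)
Lemma asc_eq1 w : (forall i j, j = i.+1 :> nat -> (w i < w j)%N) -> w = 1%g.
Proof.
move=> /asc_mono h.
have h' k m : (k < m)%N -> (w^-1%g k < w^-1%g m)%N.
  move=> km; case: (ltngtP (w^-1%g k) (w^-1%g m)) => // [|/val_inj/perm_inj e].
    by move=> /h; rewrite !permKV; lia.
  by rewrite e ltnn in km.
apply/permP => k; rewrite perm1; apply: val_inj; apply/eqP; rewrite eqn_leq.
rewrite (mono_ge _ h) andbT.
by have := mono_ge _ h' (w k); rewrite permK.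
Qed.

Lemma descentP w : w = 1%g \/ exists i j, j = i.+1 :> nat /\ (w j < w i)%N.
Proof.
case: (boolP [exists p : 'I_n * 'I_n, (val p.2 == (val p.1).+1) && (w p.2 < w p.1)%N]).
  by case/existsP => -[i j] /= /andP[/eqP h1 h2]; right; exists i, j.
rewrite negb_exists => /forallP h; left; apply: asc_eq1 => i j hij.
have := h (i, j); rewrite /= hij eqxx /= -leqNgt => hw.
by rewrite ltn_neqAle hw perm_adj_neq.
Qed.

Lemma perm_ind_right (P : 'S_n -> Prop) : P 1%g ->
  (forall w i j, j = i.+1 :> nat -> (w i < w j)%N -> P w -> P (comp w (tperm i j))) ->
  forall w, P w.
Proof.
move=> P1 PS w; have [d] := ubnP (len w); elim: d w => // d IH w hd.
case: (descentP w) => [->//|[i [j [hij hw]]]].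
rewrite -(compK i j w); apply: PS => //; first by rewrite !compE tpermL tpermR.
by apply: IH; move: hd; rewrite (len_desc _ _ _ hij hw).
Qed.

Lemma perm_ind_left (P : 'S_n -> Prop) : P 1%g ->
  (forall w i j, j = i.+1 :> nat -> (w^-1%g i < w^-1%g j)%N -> P w ->
     P (comp (tperm i j) w)) ->
  forall w, P w.
Proof.
move=> P1 PS w; rewrite -(invgK w); move: (w^-1%g).
apply: perm_ind_right => [|v i j hij hv Pv]; first by rewrite invg1.
by rewrite comp_inv tpermV; apply: PS => //; rewrite invgK.
Qed.

End SymmetricGroup.

(** * The Hecke algebra: coefficient formulas and associativity *)

Section HeckeAlgebra.
Variable n : nat.
Local Notation hecke := {ffun 'S_n -> K}.
Implicit Types (w v y : 'S_n) (i j k m : 'I_n) (h g : hecke) (a b : K).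

Lemma tt_neq0 : tt != 0.
Proof. by rewrite /tt tofrac_eq0 polyX_eq0. Qed.

Lemma hscE a h w : hsc a h w = a * h w.
Proof. by rewrite ffunE. Qed.

Lemma haddE h g w : (h + g) w = h w + g w.
Proof. by rewrite ffunE. Qed.

Lemma T_E w v : T_ w v = (v == w)%:R.
Proof. by rewrite ffunE. Qed.

Lemma hsum_basis h : h = \sum_w hsc (h w) (T_ w).
Proof.
apply/ffunP => w; rewrite sum_ffunE (bigD1 w) //= big1 => [|v hv].
  by rewrite hscE T_E eqxx mulr1 addr0.
by rewrite hscE T_E eq_sym (negbTE hv) mulr0.
Qed.

Lemma hscA a b h : hsc a (hsc b h) = hsc (a * b) h.
Proof. by apply/ffunP => w; rewrite !hscE mulrA. Qed.

Lemma hsc1 h : hsc 1 h = h.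
Proof. by apply/ffunP => w; rewrite hscE mul1r. Qed.

Definition hlin (f : hecke -> hecke) : Prop :=
  (forall h g, f (h + g) = f h + f g) /\ (forall a h, f (hsc a h) = hsc a (f h)).

Lemma hlin0 f : hlin f -> f 0 = 0.
Proof.
have e : (0 : hecke) = hsc 0 0 by apply/ffunP => w; rewrite hscE ffunE mul0r.
by move=> [_ f2]; rewrite e f2; apply/ffunP => w; rewrite !hscE !mul0r.
Qed.

Lemma hlin_sum f (I : Type) (r : seq I) (P : pred I) (F : I -> hecke) :
  hlin f -> f (\sum_(x <- r | P x) F x) = \sum_(x <- r | P x) f (F x).
Proof.
by move=> hf; apply: (big_morph f) => [h g|]; [case: hf => -> | exact: hlin0].
Qed.

Lemma hlin_ext f1 f2 : hlin f1 -> hlin f2 ->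
  (forall w, f1 (T_ w) = f2 (T_ w)) -> forall h, f1 h = f2 h.
Proof.
move=> l1 l2 e h; rewrite (hsum_basis h) !hlin_sum //; apply: eq_bigr => w _.
by case: l1 => _ ->; case: l2 => _ ->; rewrite e.
Qed.

Lemma hlin_comp f1 f2 : hlin f1 -> hlin f2 -> hlin (fun h => f1 (f2 h)).
Proof.
by move=> [a1 s1] [a2 s2]; split=> [h g|a h]; rewrite ?a2 ?s2 ?a1 ?s1.
Qed.

Lemma hsc_lin a : hlin (hsc a).
Proof.
split=> [h g|b h]; apply/ffunP => w; rewrite !(hscE, haddE); ring.
Qed.

(** Only the terms at [w] and at its right translate reach the coefficient at [w]. In this form many
    identities below become case splits closed by [ring]. *)
Lemma rmul_sE i j h w : j = i.+1 :> nat -> rmul_s i j h w =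
  if (w i < w j)%N then tt * h (comp w (tperm i j))
  else h (comp w (tperm i j)) + (tt - 1) * h w.
Proof.
move=> hij; rewrite /rmul_s sum_ffunE.
set s := tperm i j.
have wK := compK _ i j; rewrite -/s in wK.
have nws : w != comp w s.
  apply/eqP => /(congr1 (fun v : 'S_n => v i)).
  by rewrite compE tpermL => /(congr1 val)/eqP; rewrite perm_adj_neq.
have nij : (comp w s i < comp w s j)%N = ~~ (w i < w j)%N.
  by rewrite !compE tpermL tpermR ltn_neqAle eq_sym perm_adj_neq //= leqNgt.
rewrite (bigD1 (comp w s)) //= (bigD1 w) //= big1 => [|v /andP[v1 v2]].
  rewrite !hscE !len_lt // nij wK.
  case: (w i < w j)%N => /=; rewrite !(hscE, haddE, T_E) eqxx ?(negbTE nws) /=; ring.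
have n1 : (w == comp v s) = false.
  by apply/negbTE; apply: contraNneq v1 => ->; rewrite wK.
rewrite hscE; case: ifP => _;
  rewrite !(hscE, haddE, T_E) n1 ?[w == v]eq_sym ?(negbTE v2) /=; ring.
Qed.

Lemma rmul_s_lin i j : j = i.+1 :> nat -> hlin (rmul_s i j).
Proof.
move=> hij; split=> [h g|a h]; apply/ffunP => w;
  rewrite !(rmul_sE, hscE, haddE) //; case: ifP => _; ring.
Qed.

Lemma rmul_sT i j w : j = i.+1 :> nat -> (w i < w j)%N ->
  rmul_s i j (T_ w) = T_ (comp w (tperm i j)).
Proof.
move=> hij hw; apply/ffunP => v; rewrite rmul_sE // !T_E.
have -> : (comp v (tperm i j) == w) = (v == comp w (tperm i j)).
  by apply/eqP/eqP => [<-|->]; rewrite compK.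
have [->|_] := eqVneq v (comp w (tperm i j)).
  have [e|_] := eqVneq (comp w (tperm i j)) w.
    by move: hw; rewrite -{1}e compE tpermL ltnn.
  by rewrite !compE tpermL tpermR ltnNge (ltnW hw) /=; ring.
case: ifP => hv; first by rewrite mulr0.
have [e|_] := eqVneq v w; first by rewrite e hw in hv.
by rewrite mulr0 addr0.
Qed.

(* Left multiplication by T_s, s = (i, j), read off on coefficients. *)
Definition lmul_s i j h : hecke := [ffun w : 'S_n =>
  if (w^-1%g i < w^-1%g j)%N then tt * h (comp (tperm i j) w)
  else h (comp (tperm i j) w) + (tt - 1) * h w].

Lemma lmul_sT i j w : j = i.+1 :> nat -> (w^-1%g i < w^-1%g j)%N ->
  lmul_s i j (T_ w) = T_ (comp (tperm i j) w).
Proof.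
move=> hij hw; apply/ffunP => v; rewrite ffunE !T_E.
have -> : (comp (tperm i j) v == w) = (v == comp (tperm i j) w).
  by apply/eqP/eqP => [<-|->]; rewrite compKl.
have [->|_] := eqVneq v (comp (tperm i j) w).
  have [e|_] := eqVneq (comp (tperm i j) w) w.
    by move: hw; rewrite -{1}e comp_inv tpermV compE tpermL ltnn.
  by rewrite !comp_inv tpermV !compE tpermL tpermR ltnNge (ltnW hw) /=; ring.
case: ifP => hv; first by rewrite mulr0.
have [e|_] := eqVneq v w; first by rewrite e hw in hv.
by rewrite mulr0 addr0.
Qed.

Lemma lmul_s_lin i j : hlin (lmul_s i j).
Proof.
split=> [h g|a h]; apply/ffunP => w;
  rewrite !(ffunE, hscE, haddE) //; case: ifP => _; ring.
Qed.

(** Either the left and right translates of [w] coincide, or neither translation affects the ascent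
    test of the other. *)
Lemma lmul_rmul i j k m h : j = i.+1 :> nat -> m = k.+1 :> nat ->
  lmul_s k m (rmul_s i j h) = rmul_s i j (lmul_s k m h).
Proof.
move=> hij hkm; apply/ffunP => w; rewrite ffunE !rmul_sE // !ffunE.
rewrite !comp_inv !tpermV !compE !compA.
have wV x z : w^-1%g x = z -> w z = x by move=> <-; rewrite permKV.
(* Here the two translates of [w] coincide, and translating flips both ascent tests at once. *)
case: (boolP ((w^-1%g k == i) && (w^-1%g m == j))) => [/andP[/eqP e1 /eqP e2]|n1].
  rewrite e1 e2 (wV _ _ e1) (wV _ _ e2) !tpermL !tpermR hij hkm ltnSn ltnNge leqnSn /=.
  rewrite ltnSn ltnNge leqnSn /=.
  have -> : comp (tperm k m) w = comp w (tperm i j).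
    by rewrite -e1 -e2 /comp -tpermJ conjgE invgK mulgA mulgKV.
  ring.
case: (boolP ((w^-1%g k == j) && (w^-1%g m == i))) => [/andP[/eqP e1 /eqP e2]|n2].
  rewrite e1 e2 (wV _ _ e1) (wV _ _ e2) !tpermL !tpermR hij hkm ltnSn ltnNge leqnSn /=.
  rewrite ltnSn ltnNge leqnSn /=.
  have -> : comp (tperm k m) w = comp w (tperm i j).
    by rewrite -e1 -e2 tpermC /comp -tpermJ conjgE invgK mulgA mulgKV.
  ring.
rewrite !tperm_adj_ltn //.
- case: (w i < w j)%N; case: (_ < _)%N; ring.
- by case=> e1 e2; rewrite e1 e2 !eqxx in n1.
- by case=> e1 e2; rewrite e1 e2 !eqxx in n2.
- by case=> e1 e2; rewrite -e1 -e2 !permK !eqxx in n1.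
- by case=> e1 e2; rewrite -e1 -e2 !permK !eqxx in n2.
Qed.

(** The recursion only composes right multiplications by generators, so a property kept by each of
    them passes to [rmulw] whichever reduced word was picked. *)
Lemma rmulw_fuel_ind (P : (hecke -> hecke) -> Prop) : P id ->
  (forall f i j, j = i.+1 :> nat -> P f -> P (fun h => rmul_s i j (f h))) ->
  forall (d : nat) v, P (rmulw_fuel d v).
Proof.
move=> P1 PS; elim=> [|d IH] v //=; case: pickP => [[i j] /= /andP[/eqP hij _]|_] //.
exact: PS.
Qed.

Lemma rmulw_lin v : hlin (rmulw v).
Proof.
apply: (rmulw_fuel_ind hlin) => [|f i j hij hf]; first by split.
by apply: hlin_comp => //; apply: rmul_s_lin.
Qed.

(** This stands in for left linearity until associativity is available. *)
Definition left_equivariant (f : hecke -> hecke) : Prop :=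
  forall k m h, m = k.+1 :> nat -> f (lmul_s k m h) = lmul_s k m (f h).

Lemma rmulw_equiv v : left_equivariant (rmulw v).
Proof.
apply: (rmulw_fuel_ind left_equivariant) => [//|f i j hij hf] k m h hkm.
by rewrite hf // lmul_rmul.
Qed.

(** Each recursive call removes one descent and lowers the length by one, so the fuel runs out
    exactly at the identity. *)
Lemma rmulw_one v : rmulw v (hone n) = T_ v.
Proof.
rewrite /rmulw; move: {2}(len v) (erefl (len v)) => k.
elim: k v => [|k IH] v hk; rewrite hk /=.
  case: (descentP _ v) => [->//|[i [j [hij hv]]]].
  by rewrite (len_desc _ _ _ _ hij hv) in hk.
case: pickP => [[i j] /= /andP[/eqP hij hv]|hv].
  rewrite (len_desc _ _ _ _ hij hv) in hk; case: hk => hk.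
  have := IH _ hk; rewrite hk => ->.
  by rewrite rmul_sT ?compK // !compE tpermL tpermR.
case: (descentP _ v) => [->//|[i [j [hij hv']]]].
by have := hv (i, j); rewrite /= hij eqxx hv'.
Qed.

Lemma hmul_linl g : hlin (fun h => hmul h g).
Proof.
split=> [h1 h2|a h]; rewrite /hmul.
  rewrite -big_split /=; apply: eq_bigr => v _.
  by case: (rmulw_lin v) => -> _; case: (hsc_lin (g v)) => ->.
rewrite hlin_sum; last exact: hsc_lin.
by apply: eq_bigr => v _; case: (rmulw_lin v) => _ ->; rewrite !hscA mulrC.
Qed.

Lemma hmul_linr h : hlin (hmul h).
Proof.
split=> [h1 h2|a g]; rewrite /hmul.
  rewrite -big_split /=; apply: eq_bigr => v _; apply/ffunP => w.
  by rewrite !(hscE, haddE) mulrDl.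
rewrite hlin_sum; last exact: hsc_lin.
by apply: eq_bigr => v _; rewrite hscE hscA.
Qed.

Lemma hmul_equiv g : left_equivariant (fun h => hmul h g).
Proof.
move=> k m h hkm; rewrite /hmul hlin_sum; last exact: lmul_s_lin.
apply: eq_bigr => v _; rewrite rmulw_equiv //.
by case: (lmul_s_lin k m) => _ ->.
Qed.

Lemma hmul1l g : hmul (hone n) g = g.
Proof. by rewrite {2}(hsum_basis g); apply: eq_bigr => v _; rewrite rmulw_one. Qed.

(* The left multiplications by the T_s generate H_n from the unit, so an
   operator commuting with all of them is determined by its value there. *)
Lemma equivariant_ext f1 f2 : hlin f1 -> hlin f2 ->
  left_equivariant f1 -> left_equivariant f2 -> f1 (hone n) = f2 (hone n) ->
  forall h, f1 h = f2 h.
Proof.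
move=> l1 l2 c1 c2 e; apply: hlin_ext => //.
apply: perm_ind_left => // w i j hij hw IH.
by rewrite -lmul_sT // c1 // c2 // IH.
Qed.

Lemma hmulA h g (k : hecke) : hmul h (hmul g k) = hmul (hmul h g) k.
Proof.
symmetry; move: h; apply: equivariant_ext.
- exact: (hlin_comp (fun h => hmul h k) (fun h => hmul h g) (hmul_linl k) (hmul_linl g)).
- exact: hmul_linl.
- by move=> i j h hij; rewrite !hmul_equiv.
- exact: hmul_equiv.
- by rewrite !hmul1l.
Qed.

Lemma hmul1r h : hmul h (hone n) = h.
Proof.
move: h; apply: equivariant_ext => //.
- exact: hmul_linl.
- exact: hmul_equiv.
- by rewrite hmul1l.
Qed.

Lemma rmul_s_hmul i j h : j = i.+1 :> nat -> rmul_s i j h = hmul h (T_ (tperm i j)).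
Proof.
move=> hij; move: h; apply: equivariant_ext.
- exact: rmul_s_lin.
- exact: hmul_linl.
- by move=> k m h hkm; rewrite lmul_rmul.
- exact: hmul_equiv.
- rewrite hmul1l rmul_sT // ?perm1 ?hij // /comp mulg1 //.
Qed.

Lemma lmul_s_hmul i j h : j = i.+1 :> nat -> lmul_s i j h = hmul (T_ (tperm i j)) h.
Proof.
move=> hij; rewrite -{1}(hmul1l h) -hmul_equiv // lmul_sT ?comp1 //.
by rewrite invg1 !perm1 hij.
Qed.

Lemma hmul_TT i j w : j = i.+1 :> nat -> (w i < w j)%N ->
  hmul (T_ w) (T_ (tperm i j)) = T_ (comp w (tperm i j)).
Proof. by move=> hij hw; rewrite -rmul_s_hmul // rmul_sT. Qed.

Lemma hmulZr a h g : hmul h (hsc a g) = hsc a (hmul h g).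
Proof. by case: (hmul_linr h). Qed.

Lemma hmulZl a h g : hmul (hsc a h) g = hsc a (hmul h g).
Proof. by case: (hmul_linl g). Qed.

Lemma hmulDr h g (k : hecke) : hmul h (g + k) = hmul h g + hmul h k.
Proof. by case: (hmul_linr h). Qed.

Lemma hmulDl h g (k : hecke) : hmul (h + g) k = hmul h k + hmul g k.
Proof. by case: (hmul_linl k). Qed.

(** * The trivial character *)

Definition chi h : K := \sum_w h w * tt ^+ len w.

Lemma chiD h g : chi (h + g) = chi h + chi g.
Proof. by rewrite /chi -big_split; apply: eq_bigr => w _; rewrite haddE mulrDl. Qed.

Lemma chiZ a h : chi (hsc a h) = a * chi h.
Proof. by rewrite /chi mulr_sumr; apply: eq_bigr => w _; rewrite hscE mulrA. Qed.

Lemma chi0 : chi 0 = 0.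
Proof. by rewrite /chi big1 // => w _; rewrite ffunE mul0r. Qed.

Lemma chi_sum (I : Type) (r : seq I) (P : pred I) (F : I -> hecke) :
  chi (\sum_(x <- r | P x) F x) = \sum_(x <- r | P x) chi (F x).
Proof. by apply: (big_morph chi) => [h g|]; [exact: chiD | exact: chi0]. Qed.

Lemma chiT w : chi (T_ w) = tt ^+ len w.
Proof.
rewrite /chi (bigD1 w) //= big1 ?T_E ?eqxx ?mul1r ?addr0 // => v hv.
by rewrite T_E (negbTE hv) mul0r.
Qed.

Lemma chi_rmul_s i j h : j = i.+1 :> nat -> chi (rmul_s i j h) = tt * chi h.
Proof.
move=> hij; rewrite (hsum_basis h) hlin_sum; last exact: rmul_s_lin.
rewrite !chi_sum mulr_sumr; apply: eq_bigr => w _.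
have -> : rmul_s i j (hsc (h w) (T_ w)) = hsc (h w) (rmul_s i j (T_ w)).
  by case: (rmul_s_lin i j hij).
rewrite !chiZ chiT; case: (ltngtP (w i) (w j)) => hw.
- rewrite rmul_sT // chiT len_asc // exprS; ring.
- have hc : (comp w (tperm i j) i < comp w (tperm i j) j)%N.
    by rewrite !compE tpermL tpermR.
  (* On a descent the character gives (t - 1) t^l + t t^(l-1) = t^(l+1), where l = [len w]. *)
  have -> : rmul_s i j (T_ w) = hsc (tt - 1) (T_ w) + hsc tt (T_ (comp w (tperm i j))).
    apply/ffunP => v; rewrite rmul_sE // !(haddE, hscE, T_E).
    have -> : (comp v (tperm i j) == w) = (v == comp w (tperm i j)).
      by apply/eqP/eqP => [<-|->]; rewrite compK.
    have [->|_] := eqVneq v (comp w (tperm i j)).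
      rewrite hc; have [e|_] := eqVneq (comp w (tperm i j)) w; last by rewrite /=; ring.
      by move: hw; rewrite -{1}e compE tpermR ltnn.
    have [->|_] := eqVneq v w; first by rewrite ltnNge (ltnW hw) /=; ring.
    by case: ifP => _ /=; ring.
  rewrite chiD !chiZ !chiT (len_desc _ _ _ _ hij hw) exprS; ring.
- by move/eqP: hw; rewrite perm_adj_neq.
Qed.

Lemma chiM h g : chi (hmul h g) = chi h * chi g.
Proof.
rewrite /hmul chi_sum /(chi g) mulr_sumr; apply: eq_bigr => v _; rewrite chiZ.
suff -> : chi (rmulw v h) = tt ^+ len v * chi h by ring.
rewrite -chiT -rmulw_one /rmulw.
(* The value at the unit records the power of t collected so far, so the word itself need not be
   followed. *)
move: (rmulw_fuel_ind (fun f => chi (f h) = chi (f (hone n)) * chi h)); apply.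
  by rewrite /= /hone chiT len1 mul1r.
by move=> f i j hij IH; rewrite !chi_rmul_s // IH mulrA.
Qed.

(** * Inverses of the basis elements *)

Lemma T_square i j : j = i.+1 :> nat ->
  hmul (T_ (tperm i j)) (T_ (tperm i j)) = hsc (tt - 1) (T_ (tperm i j)) + hsc tt (hone n).
Proof.
move=> hij; rewrite -rmul_s_hmul //; apply/ffunP => v.
rewrite rmul_sE // !(haddE, hscE, T_E).
have -> : (comp v (tperm i j) == tperm i j) = (v == 1%g).
  apply/eqP/eqP => [e|->]; last by rewrite /comp mulg1.
  by rewrite -(compK _ i j v) e /comp tperm2.
have ij : (i < j)%N by rewrite hij.
have [->|_] := eqVneq v 1%g.
  rewrite !perm1 ij; have [e|_] := eqVneq 1%g (tperm i j); last by rewrite /=; ring.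
  have : i = j by rewrite -[LHS](perm1 i) e tpermL.
  by move=> /(congr1 val)/=; lia.
have [->|_] := eqVneq v (tperm i j).
  by rewrite tpermL tpermR ltnNge (ltnW ij) /=; ring.
by case: ifP => _ /=; ring.
Qed.

(* t * T_s^-1 *)
Definition Tbar i j : hecke := T_ (tperm i j) + hsc (1 - tt) (hone n).

Lemma T_Tbar i j : j = i.+1 :> nat -> hmul (T_ (tperm i j)) (Tbar i j) = hsc tt (hone n).
Proof.
move=> hij; rewrite hmulDr hmulZr hmul1r T_square //.
by apply/ffunP => w; rewrite !(haddE, hscE); ring.
Qed.

Lemma Tbar_T i j : j = i.+1 :> nat -> hmul (Tbar i j) (T_ (tperm i j)) = hsc tt (hone n).
Proof.
move=> hij; rewrite hmulDl hmulZl hmul1l T_square //.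
by apply/ffunP => w; rewrite !(haddE, hscE); ring.
Qed.

Lemma T_unit w : exists g, hmul (T_ w) g = hone n /\ hmul g (T_ w) = hone n.
Proof.
elim/perm_ind_right: w => [|w i j hij hw [g [h1 h2]]].
  by exists (hone n); rewrite !hmul1l.
(* The inverse of a generator is [Tbar] divided by t; inverses of products multiply in reverse
   order. *)
exists (hmul (hsc tt^-1 (Tbar i j)) g); rewrite -hmul_TT //; split.
  rewrite -hmulA (hmulA (T_ (tperm i j))) hmulZr T_Tbar // hscA mulVf ?tt_neq0 //.
  by rewrite hsc1 hmul1l.
rewrite -hmulA (hmulA g) h2 hmul1l hmulZl Tbar_T // hscA mulVf ?tt_neq0 //.
by rewrite hsc1.
Qed.

Lemma hinvP w : hmul (T_ w) (hinv (T_ w)) = hone n /\ hmul (hinv (T_ w)) (T_ w) = hone n.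
Proof. exact: (epsilon_spec (inhabits _) _ (T_unit w)). Qed.

(** [hinv] is a choice without a formula, so identities about it are proved after multiplying by
    some [T_ w]. *)
Lemma T_cancel w h g : hmul (T_ w) h = hmul (T_ w) g -> h = g.
Proof.
move=> e; case: (hinvP w) => _ h2.
by rewrite -(hmul1l h) -h2 -hmulA e hmulA h2 hmul1l.
Qed.

(** The factor through which a column enters [Psi]. The power of t normalises its character to 1 and
    turns the inverse of each generator into [Tbar]. *)
Definition Tinv w : hecke := hsc (tt ^+ len w) (hinv (T_ w^-1%g)).

Lemma T_Tinv w : hmul (T_ w^-1%g) (Tinv w) = hsc (tt ^+ len w) (hone n).
Proof. by rewrite hmulZr; case: (hinvP w^-1%g) => ->. Qed.

Lemma chi_Tinv w : chi (Tinv w) = 1.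
Proof.
have := congr1 chi (T_Tinv w); rewrite chiM chiZ !chiT len_inv len1 expr0.
by apply: mulfI; rewrite expf_neq0 // tt_neq0.
Qed.

Lemma Tinv1 : Tinv 1%g = hone n.
Proof.
apply: (T_cancel 1%g); have := T_Tinv 1%g.
by rewrite invg1 => ->; rewrite len1 hsc1 hmul1l.
Qed.

(** On the inverse side the new generator is appended on the right; its product with [Tbar] supplies
    the extra power of t. *)
Lemma Tinv_asc i j w : j = i.+1 :> nat -> (w^-1%g i < w^-1%g j)%N ->
  Tinv (comp (tperm i j) w) = hmul (Tbar i j) (Tinv w).
Proof.
move=> hij hw; apply: (T_cancel (comp (tperm i j) w)^-1%g); rewrite T_Tinv.
have -> : len (comp (tperm i j) w) = (len w).+1.
  by rewrite -len_inv comp_inv tpermV len_asc // len_inv.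
rewrite comp_inv tpermV -hmul_TT // -hmulA (hmulA _ (Tbar i j)) T_Tbar //.
by rewrite hmulZl hmul1l hmulZr T_Tinv hscA exprS.
Qed.

End HeckeAlgebra.

(** * Parabolic subgroups, their cosets and columns *)

Section Parabolic.
Variable n : nat.
Local Notation hecke := {ffun 'S_n -> K}.
Implicit Types (w v y : 'S_n) (i j k m : 'I_n) (h g : hecke) (a b : K).
Implicit Types (C E F : {set 'I_n}) (l : nat).

Lemma stabP l w : reflect (forall k, (w k < l)%N = (k < l)%N) (stab (varpi l) w).
Proof.
apply: (iffP forallP) => h k; have := h k; rewrite /varpi.
  by move/eqP; case: (w k < l)%N; case: (k < l)%N.
by move=> ->.
Qed.

Lemma stab_compr l w v : stab (varpi l) v -> stab (varpi l) (comp w v) = stab (varpi l) w.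
Proof.
move=> /stabP hv; apply/stabP/stabP => h k; last by rewrite compE h hv.
by rewrite -[k](permKV v) -compE h hv.
Qed.

Lemma stab_compl l w v : stab (varpi l) v -> stab (varpi l) (comp v w) = stab (varpi l) w.
Proof.
by move=> /stabP hv; apply/stabP/stabP => h k; have := h k; rewrite compE hv.
Qed.

Lemma stab_tperm l i j : (i < l)%N = (j < l)%N -> stab (varpi l) (tperm i j).
Proof. by move=> e; apply/stabP => k; case: tpermP => // ->. Qed.

(** A pair straddling the cut at [l] is sent to a pair straddling it in the same order, so no
    descent occurs there. *)
Lemma stab_desc l w i j : j = i.+1 :> nat -> stab (varpi l) w -> (w j < w i)%N ->
  (i < l)%N = (j < l)%N.
Proof. by move=> hij /stabP h; have := h i; have := h j; lia. Qed.

Lemma stab_ind_right l (P : 'S_n -> Prop) : P 1%g ->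
  (forall w i j, j = i.+1 :> nat -> (i < l)%N = (j < l)%N -> stab (varpi l) w ->
     (w i < w j)%N -> P w -> P (comp w (tperm i j))) ->
  forall w, stab (varpi l) w -> P w.
Proof.
move=> P1 PS w; have [d] := ubnP (len w); elim: d w => // d IH w hd hw.
case: (descentP _ w) => [->//|[i [j [hij hd']]]].
have e := stab_desc _ _ _ _ hij hw hd'.
have hs : stab (varpi l) (comp w (tperm i j)) by rewrite stab_compr ?stab_tperm.
rewrite -(compK _ i j w); apply: PS => //; first by rewrite !compE tpermL tpermR.
by apply: IH => //; move: hd; rewrite (len_desc _ _ _ _ hij hd').
Qed.

Lemma size_col_ord C : size (col_ord C) = #|C|.
Proof. by rewrite size_sort -cardE. Qed.

(** The entries of [C] followed by those of its complement list every position once, so the default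
    in [u_] never occurs. *)
Lemma u_nth C k : u_ C k = nth k (useq C) k.
Proof.
have sz : size (useq C) = n by rewrite size_cat !size_col_ord cardsC card_ord.
have un : uniq (useq C).
  rewrite cat_uniq !sort_uniq !enum_uniq andbT /=; apply/hasPn => x.
  by rewrite !mem_sort !mem_enum inE.
have inj : injective (fun k : 'I_n => nth k (useq C) k).
  move=> x z; rewrite (set_nth_default x) ?sz // => /eqP.
  by rewrite nth_uniq ?sz // => /eqP/val_inj.
rewrite /u_; case: pickP => [w /forallP/(_ k)/eqP -> //|/(_ (perm inj))].
by case/forallP => x; rewrite permE.
Qed.

Lemma u_mem C k : (u_ C k \in C) = (k < #|C|)%N.
Proof.
rewrite u_nth nth_cat size_col_ord; case: ifP => hk.
  by rewrite -mem_enum -(mem_sort (fun x y : 'I_n => (x <= y)%N)) mem_nth ?size_col_ord.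
apply/negbTE; rewrite -in_setC -mem_enum -(mem_sort (fun x y : 'I_n => (x <= y)%N)).
apply: mem_nth; rewrite size_col_ord.
have : (#|C| + #|~: C| = n)%N by rewrite cardsC card_ord.
have := ltn_ord k; lia.
Qed.

Lemma uV_lt C x : ((u_ C)^-1%g x < #|C|)%N = (x \in C).
Proof. by rewrite -u_mem permKV. Qed.

Lemma u_mono C k m : (k < #|C|)%N = (m < #|C|)%N -> (k < m)%N -> (u_ C k < u_ C m)%N.
Proof.
move=> e km; rewrite ltn_neqAle; apply/andP; split.
  by apply/eqP => /val_inj/perm_inj h; rewrite h ltnn in km.
have tr : transitive (fun x y : 'I_n => (x <= y)%N) by move=> ? ? ?; apply: leq_trans.
have srt D : sorted (fun x y : 'I_n => (x <= y)%N) (col_ord D).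
  by apply: sort_sorted => ? ?; apply: leq_total.
have hn : (#|C| + #|~: C| = n)%N by rewrite cardsC card_ord.
have hm := ltn_ord m.
rewrite !u_nth (set_nth_default k m) ?size_cat ?size_col_ord ?hn // !nth_cat size_col_ord -e.
case: ifP => hk.
  by apply: (sorted_ltn_nth tr k (srt C)) => //; rewrite inE size_col_ord // -e.
by apply: (sorted_ltn_nth tr k (srt (~: C))); rewrite ?inE ?size_col_ord; lia.
Qed.

Lemma u_monoE C k m : (k < #|C|)%N = (m < #|C|)%N -> (u_ C k < u_ C m)%N = (k < m)%N.
Proof.
move=> e; case: (ltngtP k m) => h; first exact: u_mono.
  by apply/negbTE; rewrite -leqNgt ltnW // u_mono.
by rewrite (val_inj h) ltnn.
Qed.

(** The inverse of [u_ C] composed with [w] preserves both blocks and increases on each; it has no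
    adjacent descent, hence is the identity. *)
Lemma u_unique C w : (forall k, (w k \in C) = (k < #|C|)%N) ->
  (forall k m, (k < #|C|)%N = (m < #|C|)%N -> (k < m)%N -> (w k < w m)%N) -> u_ C = w.
Proof.
move=> h1 h2.
have e k : ((u_ C)^-1%g (w k) < #|C|)%N = (k < #|C|)%N by rewrite uV_lt h1.
have h : comp (u_ C)^-1%g w = 1%g.
  apply: asc_eq1 => i j hij; rewrite !compE.
  have ij : (i < j)%N by rewrite hij.
  have [eb|nb] := eqVneq (i < #|C|)%N (j < #|C|)%N.
    by rewrite -(u_monoE C) ?e // !permKV h2.
  by move: (e i) (e j) nb; lia.
apply/permP => k; have := congr1 (fun v : 'S_n => u_ C (v k)) h.
by rewrite /= compE permKV perm1 => ->.
Qed.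

Lemma mem_sact i j C k : (k \in sact i j C) = (tperm i j k \in C).
Proof. by rewrite -{1}(tpermK i j k) mem_imset //; apply: perm_inj. Qed.

Lemma card_sact i j C : #|sact i j C| = #|C|.
Proof. by rewrite card_imset //; apply: perm_inj. Qed.

Lemma sactK i j C : sact i j (sact i j C) = C.
Proof. by apply/setP => k; rewrite !mem_sact tpermK. Qed.

Lemma sact_id i j C : (i \in C) = (j \in C) -> sact i j C = C.
Proof. by move=> e; apply/setP => k; rewrite mem_sact; case: tpermP => // ->. Qed.

(** The transposition reverses only the pair [i], [j], whose members lie in different blocks, so the
    translate still increases on each block. *)
Lemma u_sact i j C : j = i.+1 :> nat -> (i \in C) != (j \in C) ->
  u_ (sact i j C) = comp (tperm i j) (u_ C).
Proof.
move=> hij ne; apply: u_unique => [k|k m].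
  by rewrite mem_sact compE tpermK u_mem card_sact.
rewrite card_sact !compE => e km; apply: tperm_adj_mono => //; last exact: u_mono.
by case=> e1 e2; move: ne; rewrite -e1 -e2 !u_mem e eqxx.
Qed.

Lemma uV_adj i j C : j = i.+1 :> nat -> (i \in C) = (j \in C) ->
  (u_ C)^-1%g j = ((u_ C)^-1%g i).+1 :> nat.
Proof.
move=> hij e; set p := (u_ C)^-1%g i; set q := (u_ C)^-1%g j.
have up : u_ C p = i by rewrite permKV.
have uq : u_ C q = j by rewrite permKV.
have epq : (p < #|C|)%N = (q < #|C|)%N by rewrite !uV_lt.
have pq : (p < q)%N by rewrite -(u_monoE C) // up uq hij.
(* Otherwise the position after [p] would carry a value strictly between [i] and its successor. *)
apply/eqP; rewrite eqn_leq pq andbT leqNgt; apply/negP => hr.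
have hr' : (p.+1 < n)%N by have := ltn_ord q; lia.
pose r : 'I_n := Ordinal hr'.
have epr : (p < #|C|)%N = (r < #|C|)%N.
  by rewrite /r /=; move: #|C| (p : nat) (q : nat) epq hr => c p' q'; lia.
have e1 : (u_ C p < u_ C r)%N by apply: u_mono.
have e2 : (u_ C r < u_ C q)%N by apply: u_mono => //; rewrite -epr.
move: e1 e2; rewrite up uq hij ltnS => e1 e2; by rewrite ltnNge e2 in e1.
Qed.

Lemma comp_tperm_u i j C :
  comp (tperm i j) (u_ C) = comp (u_ C) (tperm ((u_ C)^-1%g i) ((u_ C)^-1%g j)).
Proof. by rewrite /comp -tpermJ conjgE invgK mulgA mulgKV. Qed.

(** [u_ F] increases on both blocks, so ascents met while building [y] inside the blocks remain
    ascents of the product, and lengths add. *)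
Lemma T_u_mul F y : stab (varpi #|F|) y ->
  hmul (T_ (u_ F)) (T_ y) = T_ (comp (u_ F) y).
Proof.
elim/(@stab_ind_right #|F|): y / => [|y i j hij e /stabP hy hlt IH].
  by rewrite hmul1r comp1.
rewrite -hmul_TT // hmulA IH hmul_TT ?compA //.
by rewrite !compE u_mono // !hy.
Qed.

Lemma hmul_Tu F d w : inHpar #|F| d -> hmul (T_ (u_ F)) d w = d (comp (u_ F)^-1%g w).
Proof.
move=> hd; rewrite {1}(hsum_basis _ d) hlin_sum; last exact: hmul_linr.
have eqw y : (w == comp (u_ F) y) = (y == comp (u_ F)^-1%g w).
  by apply/eqP/eqP => ->; rewrite compA /comp ?mulgV ?mulVg mulg1.
rewrite sum_ffunE (bigD1 (comp (u_ F)^-1%g w)) //= big1 => [|y hy].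
  rewrite hmulZr hscE addr0.
  have [->|hn] := eqVneq (d (comp (u_ F)^-1%g w)) 0; first by rewrite mul0r.
  by rewrite T_u_mul ?hd // T_E eqw eqxx mulr1.
rewrite hmulZr hscE; have [->|hn] := eqVneq (d y) 0; first by rewrite mul0r.
by rewrite T_u_mul ?hd // T_E eqw (negbTE hy) mulr0.
Qed.

(** The coset of [w] is read off from the image of the first positions; this makes the decomposition
    over columns unique. *)
Lemma stab_uV F w : stab (varpi #|F|) (comp (u_ F)^-1%g w) =
  (F == w @: [set k : 'I_n | (k < #|F|)%N]).
Proof.
apply/stabP/eqP => h.
  apply/setP => x; rewrite -[x](permKV w) mem_imset; last exact: perm_inj.
  by rewrite inE -h compE uV_lt.
move=> k; rewrite compE uV_lt {1}h mem_imset ?inE //; exact: perm_inj.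
Qed.

(* The H_{n,varpi_l}-component h_F of h. *)
Definition dpart l F h : hecke :=
  [ffun y : 'S_n => if stab (varpi l) y then h (comp (u_ F) y) else 0].

Lemma dpart_par l F h : inHpar l (dpart l F h).
Proof. by move=> w; rewrite ffunE; case: ifP => // _; rewrite eqxx. Qed.

Lemma is_decomp_dpart C h :
  is_decomp #|C| h [ffun F : {set 'I_n} => if #|F| == #|C| then dpart #|C| F h else 0].
Proof.
split=> [F hF|F|].
- by rewrite ffunE; case: eqP.
- rewrite ffunE; case: ifP => _; first exact: dpart_par.
  by move=> w; rewrite ffunE eqxx.
apply/ffunP => w; rewrite sum_ffunE.
set F0 := w @: [set k : 'I_n | (k < #|C|)%N].
have cF0 : #|F0| = #|C|.
  rewrite card_imset; last exact: perm_inj.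
  rewrite -(card_imset [set k : 'I_n | (k < #|C|)%N] (@perm_inj _ (u_ C))).
  congr #|pred_of_set _|; apply/setP => x.
  by rewrite -[x](permKV (u_ C)) mem_imset ?inE ?u_mem //; exact: perm_inj.
have K F : comp (u_ F) (comp (u_ F)^-1%g w) = w by rewrite /comp -mulgA mulVg mulg1.
rewrite (bigD1 F0) ?cF0 //= big1 => [|F /andP[/eqP hF nF]].
  rewrite ffunE cF0 eqxx -cF0 hmul_Tu; last exact: dpart_par.
  by rewrite ffunE stab_uV cF0 eqxx K addr0.
rewrite ffunE hF eqxx -hF hmul_Tu; last exact: dpart_par.
by rewrite ffunE stab_uV hF (negbTE nF).
Qed.

(** [decomp] is a choice, so uniqueness has to pin its value: the coefficient at [u_ C] times [y]
    receives a contribution from the column [C] alone. *)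
Lemma decomp_dpart C h : decomp #|C| h C = dpart #|C| C h.
Proof.
have [_ hp hs] : is_decomp #|C| h (decomp #|C| h).
  apply: (epsilon_spec (inhabits _) (is_decomp #|C| h)).
  by eexists; apply: is_decomp_dpart.
apply/ffunP => y; rewrite ffunE; case: ifP => hy; last first.
  by apply/eqP; apply: contraFT hy => /hp.
rewrite {2}hs sum_ffunE (bigD1 C) //= big1 => [|F /andP[/eqP hF nF]].
  rewrite hmul_Tu // addr0 compA /comp mulgV mulg1 //.
rewrite hmul_Tu; last by rewrite hF.
apply/eqP; apply: contraNT nF => /hp.
rewrite -hF stab_uV hF => /eqP ->; rewrite eq_sym -stab_uV.
by rewrite compA /comp mulgV mulg1.
Qed.

Definition gam F h : K := chi n (dpart #|F| F h).

Lemma dpartD l F h g : dpart l F (h + g) = dpart l F h + dpart l F g.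
Proof. by apply/ffunP => w; rewrite !ffunE; case: ifP; rewrite ?addr0. Qed.

Lemma dpartZ l F a h : dpart l F (hsc a h) = hsc a (dpart l F h).
Proof. by apply/ffunP => w; rewrite !ffunE; case: ifP; rewrite ?mulr0. Qed.

Lemma gamD F h g : gam F (h + g) = gam F h + gam F g.
Proof. by rewrite /gam dpartD chiD. Qed.

Lemma gamZ F a h : gam F (hsc a h) = a * gam F h.
Proof. by rewrite /gam dpartZ chiZ. Qed.

Lemma gam0 F : gam F 0 = 0.
Proof.
have -> : (0 : hecke) = hsc 0 0 by apply/ffunP => w; rewrite hscE ffunE mul0r.
by rewrite gamZ mul0r.
Qed.

Lemma gam_sum F (I : Type) (r : seq I) (P : pred I) (H : I -> hecke) :
  gam F (\sum_(x <- r | P x) H x) = \sum_(x <- r | P x) gam F (H x).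
Proof. by apply: (big_morph (gam F)) => [h g|]; [exact: gamD | exact: gam0]. Qed.

(** * Action of the generators on the functionals [gam] *)

Lemma dpart_rmul F i j h : j = i.+1 :> nat -> (i < #|F|)%N = (j < #|F|)%N ->
  dpart #|F| F (rmul_s i j h) = rmul_s i j (dpart #|F| F h).
Proof.
move=> hij e; apply/ffunP => y; rewrite ffunE !rmul_sE // !ffunE.
rewrite stab_compr ?stab_tperm //.
case: ifP => hy; last by case: ifP => _; ring.
by rewrite !compE u_monoE ?compA //; move/stabP: hy => hy; rewrite !hy.
Qed.

Lemma gam_rmul F i j h : j = i.+1 :> nat -> (i < #|F|)%N = (j < #|F|)%N ->
  gam F (rmul_s i j h) = tt * gam F h.
Proof. by move=> hij e; rewrite /gam dpart_rmul // chi_rmul_s. Qed.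

(** The whole coset of [u_ F] has the left ascent, because [i] comes from the first block and [j]
    from the second; translation leads to the coset of [sact i j F]. *)
Lemma gam_lmul_asc F i j h : j = i.+1 :> nat -> i \in F -> j \notin F ->
  gam F (lmul_s n i j h) = tt * gam (sact i j F) h.
Proof.
move=> hij iF jF; rewrite /gam -chiZ; congr (chi n _); apply/ffunP => y.
rewrite hscE !ffunE card_sact; case: ifP => hy; last by rewrite mulr0.
rewrite u_sact ?iF ?(negbTE jF) // -compA comp_inv !compE.
suff -> : (y^-1%g ((u_ F)^-1%g i) < y^-1%g ((u_ F)^-1%g j))%N by [].
move/stabP: hy => hy.
have := hy (y^-1%g ((u_ F)^-1%g i)); have := hy (y^-1%g ((u_ F)^-1%g j)).
by rewrite !permKV !uV_lt iF (negbTE jF); lia.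
Qed.

Lemma gam_lmul_desc F i j h : j = i.+1 :> nat -> i \notin F -> j \in F ->
  gam F (lmul_s n i j h) = gam (sact i j F) h + (tt - 1) * gam F h.
Proof.
move=> hij iF jF; rewrite /gam -chiZ -chiD; congr (chi n _); apply/ffunP => y.
rewrite haddE hscE !ffunE card_sact; case: ifP => hy; last by rewrite mulr0 addr0.
rewrite u_sact ?jF ?(negbTE iF) // -compA comp_inv !compE.
suff -> : (y^-1%g ((u_ F)^-1%g i) < y^-1%g ((u_ F)^-1%g j))%N = false by [].
move/stabP: hy => hy.
have := hy (y^-1%g ((u_ F)^-1%g i)); have := hy (y^-1%g ((u_ F)^-1%g j)).
by rewrite !permKV !uV_lt jF (negbTE iF); lia.
Qed.

(** With [i] and [j] in one block, left translation becomes a generator of the parabolic acting on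
    the component, and its character is t. *)
Lemma gam_lmul_id F i j h : j = i.+1 :> nat -> (i \in F) = (j \in F) ->
  gam F (lmul_s n i j h) = tt * gam F h.
Proof.
move=> hij e; set p := (u_ F)^-1%g i; set q := (u_ F)^-1%g j.
have pq : q = p.+1 :> nat by apply: uV_adj.
have epq : (p < #|F|)%N = (q < #|F|)%N by rewrite !uV_lt.
have cT : chi n (T_ (tperm p q)) = tt.
  by rewrite -[T_ _](hmul1l n) -rmul_s_hmul // chi_rmul_s // chiT len1 mulr1.
(* Reading t as the character of a generator reduces the claim to an identity of components. *)
rewrite /gam -{1}cT -chiM -lmul_s_hmul //; congr (chi n _); apply/ffunP => y.
rewrite !ffunE stab_compl ?stab_tperm //.
case: ifP => hy; last by case: ifP => _; ring.
by rewrite comp_inv !compE !compA comp_tperm_u.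
Qed.

Lemma gam_Tbar F i j h : j = i.+1 :> nat ->
  gam F (hmul (Tbar n i j) h) = gam F (lmul_s n i j h) + (1 - tt) * gam F h.
Proof. by move=> hij; rewrite hmulDl hmulZl hmul1l gamD gamZ lmul_s_hmul. Qed.

(** * Parabolic symmetrizers and one-column elements *)

Lemma one_parE l w : one_par n l w = (stab (varpi l) w)%:R.
Proof.
rewrite /one_par sum_ffunE; case: (boolP (stab (varpi l) w)) => hw.
  rewrite (bigD1 w) //= T_E eqxx big1 ?addr0 // => v /andP[_ hv].
  by rewrite T_E eq_sym (negbTE hv).
rewrite big1 // => v hv; rewrite T_E; case: eqP => // e.
by rewrite e hv in hw.
Qed.

Lemma chi_one_par l : chi n (one_par n l) = Wpoly (@varpi n l).
Proof. by rewrite /one_par chi_sum; apply: eq_bigr => w _; rewrite chiT. Qed.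

Lemma Ts_one_par l i j : j = i.+1 :> nat -> (i < l)%N = (j < l)%N ->
  hmul (T_ (tperm i j)) (one_par n l) = hsc tt (one_par n l).
Proof.
move=> hij e; rewrite -lmul_s_hmul //; apply/ffunP => w.
rewrite hscE ffunE !one_parE stab_compl ?stab_tperm //.
by case: ifP => _; ring.
Qed.

Lemma par_one_par l g : inHpar l g -> hmul g (one_par n l) = hsc (chi n g) (one_par n l).
Proof.
move=> hg; rewrite {1}(hsum_basis _ g) (hlin_sum n (fun h => hmul h (one_par n l)));
  last exact: hmul_linl.
have -> : hsc (chi n g) (one_par n l) = \sum_w hsc (g w * tt ^+ len w) (one_par n l).
  move: (one_par n l) => op; apply/ffunP => v; rewrite hscE sum_ffunE /chi mulr_suml.
  by apply: eq_bigr => w _; rewrite hscE.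
apply: eq_bigr => w _; rewrite hmulZl -hscA.
have [->|/hg hw] := eqVneq (g w) 0.
  by apply/ffunP => v; rewrite !hscE !mul0r.
congr (hsc _ _); elim/(@stab_ind_right l): w / hw => [|w i j hij e hw hlt IH].
  by rewrite hmul1l len1 hsc1.
by rewrite -hmul_TT // -hmulA Ts_one_par // hmulZr IH hscA len_asc // exprS.
Qed.

Lemma PsiColE C : PsiCol C = hmul (Tinv n (u_ C)) (one_par n #|C|).
Proof. by rewrite /PsiCol hmulZl. Qed.

Lemma PsiCol_asc i j C : j = i.+1 :> nat -> i \in C -> j \notin C ->
  PsiCol (sact i j C) = hmul (Tbar n i j) (PsiCol C).
Proof.
move=> hij iC jC; rewrite !PsiColE card_sact u_sact ?iC ?(negbTE jC) //.
rewrite Tinv_asc ?hmulA //.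
by have := uV_lt C i; have := uV_lt C j; rewrite iC (negbTE jC); lia.
Qed.

(** The generator passes through [Tinv] and becomes one of the parabolic, which acts on the
    symmetrizer by t; so [Tbar] acts by t + (1 - t) = 1. *)
Lemma PsiCol_id i j C : j = i.+1 :> nat -> (i \in C) = (j \in C) ->
  hmul (Tbar n i j) (PsiCol C) = PsiCol C.
Proof.
move=> hij e; set p := (u_ C)^-1%g i; set q := (u_ C)^-1%g j.
have pq : q = p.+1 :> nat by apply: uV_adj.
have epq : (p < #|C|)%N = (q < #|C|)%N by rewrite !uV_lt.
have TT : hmul (T_ (u_ C)^-1%g) (T_ (tperm i j)) = hmul (T_ (tperm p q)) (T_ (u_ C)^-1%g).
  rewrite hmul_TT // -?/p -?/q ?pq // -lmul_s_hmul // lmul_sT // ?invgK ?permKV ?hij //.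
  have := congr1 (fun w : 'S_n => w^-1%g) (comp_tperm_u i j C).
  by rewrite !comp_inv !tpermV => ->.
have TP : hmul (T_ (tperm i j)) (Tinv n (u_ C)) = hmul (Tinv n (u_ C)) (T_ (tperm p q)).
  apply: (T_cancel n (u_ C)^-1%g).
  by rewrite !hmulA TT T_Tinv hmulZl hmul1l -hmulA T_Tinv hmulZr hmul1r.
rewrite PsiColE hmulDl hmulZl hmul1l hmulA TP -hmulA Ts_one_par // hmulZr.
by apply/ffunP => w; rewrite !(haddE, hscE); ring.
Qed.

Lemma PsiCol_sact i j C : j = i.+1 :> nat -> ~~ ((i \in C) && (j \notin C)) ->
  PsiCol C = hmul (Tbar n i j) (PsiCol (sact i j C)).
Proof.
move=> hij hC; have [e|ne] := eqVneq (i \in C) (j \in C).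
  by rewrite sact_id // PsiCol_id.
rewrite -PsiCol_asc ?sactK // mem_sact ?tpermL ?tpermR //;
  by move: hC ne; case: (i \in C); case: (j \in C).
Qed.

Lemma u1_col C : u_ C = 1%g -> C = [set k : 'I_n | (k < #|C|)%N].
Proof. by move=> h; apply/setP => k; rewrite inE -uV_lt h invg1 perm1. Qed.

(** If [u_ C] is not the identity, its inverse has a descent. Two members of one block occupy
    consecutive increasing positions, so the descent has [i] outside [C] and [j] inside; lowering
    [j] to [i] shortens [u_ C]. *)
Lemma col_ind (P : {set 'I_n} -> Prop) :
  (forall C, u_ C = 1%g -> P C) ->
  (forall C i j, j = i.+1 :> nat -> i \notin C -> j \in C -> P (sact i j C) -> P C) ->
  forall C, P C.
Proof.
move=> P1 PS C; have [d] := ubnP (len (u_ C)); elim: d C => // d IH C hd.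
case: (descentP _ (u_ C)^-1%g) => [h|[i [j [hij hw]]]].
  by apply: P1; rewrite -(invgK (u_ C)) h invg1.
have ne : (i \in C) != (j \in C).
  apply/eqP => e; have := uV_adj _ _ _ hij e; lia.
have [iC jC] : i \notin C /\ j \in C.
  move: ne; rewrite -!uV_lt; lia.
apply: (PS C i j) => //; apply: IH; rewrite u_sact //.
move: hd; rewrite -len_inv (len_desc _ _ _ _ hij hw) -(len_inv _ (comp (tperm i j) _)).
by rewrite comp_inv tpermV.
Qed.

End Parabolic.

(** * Poincare polynomials of stabilizers *)

Section Poincare.
Variable n : nat.
Implicit Types (w v y : 'S_n) (i j k m : 'I_n) (lam mu : 'I_n -> nat) (l : nat).

Lemma Wpoly_neq0 lam : Wpoly lam != 0.
Proof.
pose p : {poly rat} := \sum_(w | stab lam w) 'X ^+ len w.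
have -> : Wpoly lam = FracField.tofrac p.
  by rewrite rmorph_sum; apply: eq_bigr => w _; rewrite rmorphXn.
(* At t = 1 the sum counts the stabilizer, which contains the identity. *)
rewrite tofrac_eq0; apply/eqP => /(congr1 (horner^~ 1)).
rewrite horner0 horner_sum (eq_bigr (fun=> 1)) => [|w _]; last by rewrite hornerXn expr1n.
rewrite sumr_const => /eqP; rewrite Num.Theory.pnatr_eq0 => /eqP/card0_eq/(_ 1%g).
by rewrite unfold_in /= => /negbT/negP; apply; apply/forallP => k; rewrite perm1.
Qed.

Lemma eq_Wpoly lam mu : (forall w, stab lam w = stab mu w) -> Wpoly lam = Wpoly mu.
Proof. by move=> e; apply: eq_bigl. Qed.

Definition fix_hi l w : bool := [forall k : 'I_n, (l <= k)%N ==> (w k == k)].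
Definition fix_lo l w : bool := [forall k : 'I_n, (k < l)%N ==> (w k == k)].

Definition Wlo lam l : K := \sum_(w | stab lam w && fix_hi l w) tt ^+ len w.
Definition Whi lam l : K := \sum_(w | stab lam w && fix_lo l w) tt ^+ len w.

Lemma fix_hi_ge l w k : fix_hi l w -> (l <= k)%N -> w k = k.
Proof. by move=> /forallP/(_ k)/implyP h /h/eqP. Qed.

Lemma fix_lo_lt l w k : fix_lo l w -> (k < l)%N -> w k = k.
Proof. by move=> /forallP/(_ k)/implyP h /h/eqP. Qed.

Lemma fix_hi_lt l w k : fix_hi l w -> (w k < l)%N = (k < l)%N.
Proof.
move=> h; case: (ltnP k l) => hk; last by rewrite (fix_hi_ge l) // ltnNge hk.
case: (ltnP (w k) l) => // hw; have /perm_inj e := fix_hi_ge _ _ _ h hw.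
by rewrite e leqNgt hk in hw.
Qed.

Lemma fix_lo_ge l w k : fix_lo l w -> (w k < l)%N = (k < l)%N.
Proof.
move=> h; case: (ltnP k l) => hk; first by rewrite (fix_lo_lt l).
apply/negbTE; rewrite -leqNgt; case: (leqP l (w k)) => // hw.
have /perm_inj e := fix_lo_lt _ _ _ h hw.
by rewrite e ltnNge hk in hw.
Qed.

(** Neither factor moves a position across [l], so no inversion straddles it, and the inversions of
    the product are the disjoint union of those of the factors. *)
Lemma len_lo_hi l w v : fix_hi l w -> fix_lo l v -> len (comp w v) = (len w + len v)%N.
Proof.
move=> hw hv; rewrite /len.
set A := [set p | _]; set B := [set p | _]; set D := [set p | _].
have lo k : (k < l)%N -> comp w v k = w k by move=> hk; rewrite compE (fix_lo_lt l v).
have hi k : (l <= k)%N -> comp w v k = v k.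
  by move=> hk; rewrite compE (fix_hi_ge l) // leqNgt (fix_lo_ge l) // -leqNgt.
have wlt k : (k < l)%N -> (w k < l)%N by move=> hk; rewrite (fix_hi_lt l).
have vge k : (l <= k)%N -> (l <= v k)%N.
  by move=> hk; rewrite leqNgt (fix_lo_ge l) // -leqNgt.
have asym (x z : 'I_n) : (x < z)%N && (z < x)%N = false by case: ltngtP.
rewrite -cardsUI.
have -> : B :&: D = set0.
  apply/setP => -[a b]; rewrite !inE /=.
  case: (ltnP a l) => ha; case: (ltnP b l) => hb.
  - by rewrite !(fix_lo_lt l v) // asym andbF.
  - by rewrite (fix_hi_ge l w b) // [(b < w a)%N]ltnNge (ltnW (leq_trans (wlt _ ha) hb)) andbF.
  - by rewrite ltnNge (ltnW (leq_trans hb ha)).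
  - by rewrite !(fix_hi_ge l w) // asym.
rewrite cards0 addn0; congr #|pred_of_set _|; apply/setP => -[a b]; rewrite !inE /=.
case: (ltnP a l) => ha; case: (ltnP b l) => hb.
- by rewrite !lo // !(fix_lo_lt l v) // asym orbF.
- rewrite (lo a) // (hi b) // (fix_hi_ge l w b) // (fix_lo_lt l v a) //.
  rewrite [(v b < w a)%N]ltnNge (ltnW (leq_trans (wlt _ ha) (vge _ hb))).
  rewrite [(b < w a)%N]ltnNge (ltnW (leq_trans (wlt _ ha) hb)).
  by rewrite [(v b < a)%N]ltnNge (ltnW (leq_trans ha (vge _ hb))) andbF.
- by rewrite [(a < b)%N]ltnNge (ltnW (leq_trans hb ha)).
- by rewrite !hi // !(fix_hi_ge l w) // asym.
Qed.

Lemma stab_eq lam w : stab lam w -> forall k, lam (w k) = lam k.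
Proof. by move=> /forallP h k; apply/eqP. Qed.

(** Separation forces the stabilizer to preserve the cut at [l]; restriction to the two sides
    inverts composition, and lengths add by [len_lo_hi]. *)
Lemma Wpoly_split lam l :
  (forall k m, (k < l)%N -> (l <= m)%N -> lam k <> lam m) ->
  Wpoly lam = Wlo lam l * Whi lam l.
Proof.
move=> sep; pose S := [set k : 'I_n | (k < l)%N].
have inN w : stab lam w -> (w \in 'N(S | 'P))%g /\ (w \in 'N(~: S | 'P))%g.
  move=> hw; have e k : (w k < l)%N = (k < l)%N.
    have hk := stab_eq _ _ hw k; case: (ltnP (w k) l); case: (ltnP k l) => // h1 h2.
      by case: (sep _ _ h2 h1).
    by case: (sep _ _ h1 h2).
  by split; apply/astabsP => k; rewrite !inE /= apermE e.
have loE w k : stab lam w -> restr_perm S w k = if (k < l)%N then w k else k.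
  move=> hw; case: (inN w hw) => h1 _; case: ifP => hk.
    by rewrite restr_permE // inE.
  by rewrite (out_perm (restr_perm_on S w)) // inE hk.
have hiE w k : stab lam w -> restr_perm (~: S) w k = if (k < l)%N then k else w k.
  move=> hw; case: (inN w hw) => _ h1; case: ifP => hk.
    by rewrite (out_perm (restr_perm_on (~: S) w)) // !inE hk.
  by rewrite restr_permE // !inE hk.
rewrite /Wlo /Whi big_distrlr /= pair_big /= /Wpoly.
rewrite (reindex_onto (fun p : 'S_n * 'S_n => comp p.1 p.2)
  (fun w => (restr_perm S w, restr_perm (~: S) w))) /=.
  apply: eq_big => [[w v]|[w v] /andP[hs]] /=.
    apply/andP/andP => [[hs /eqP [e1 e2]]|[/andP[sw hw] /andP[sv hv]]].
      have E1 k : w k = if (k < l)%N then comp w v k else k by rewrite -loE ?e1.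
      have E2 k : v k = if (k < l)%N then k else comp w v k by rewrite -hiE ?e2.
      split; apply/andP; split; apply/forallP => k; rewrite ?E1 ?E2.
      - by case: ifP => // _; rewrite stab_eq.
      - by rewrite ltnNge; case: (leqP l k) => //= _; rewrite eqxx.
      - by case: ifP => // _; rewrite stab_eq.
      - by case: (ltnP k l) => //= _; rewrite eqxx.
    have hs : stab lam (comp w v).
      by apply/forallP => k; rewrite compE !stab_eq.
    split=> //; apply/eqP; congr (_, _); apply/permP => k; rewrite ?loE ?hiE // compE.
      by case: (ltnP k l) => hk; [rewrite (fix_lo_lt l v) | rewrite (fix_hi_ge l w)].
    case: (ltnP k l) => hk; first by rewrite (fix_lo_lt l v).
    by rewrite (fix_hi_ge l w) // leqNgt (fix_lo_ge l) // -leqNgt.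
  move=> /eqP [e1 e2]; rewrite -exprD (len_lo_hi l) //.
    apply/forallP => k; rewrite -(congr1 (fun u : 'S_n => u k) e1) loE // ltnNge.
    by case: (leqP l k) => //= _; rewrite eqxx.
  apply/forallP => k; rewrite -(congr1 (fun u : 'S_n => u k) e2) hiE //.
  by case: (ltnP k l) => //= _; rewrite eqxx.
move=> w hw; have [h1 h2] := inN w hw; apply/permP => k; rewrite compE hiE // loE //.
have e : (w k < l)%N = (k < l)%N.
  by move/astabsP: h1 => /(_ k); rewrite !inE /= apermE.
by case: (ltnP k l) => hk; rewrite ?hk // e ltnNge hk.
Qed.

Lemma eq_Wlo lam mu l :
  (forall k m, (k < l)%N -> (m < l)%N -> (lam k == lam m) = (mu k == mu m)) ->
  Wlo lam l = Wlo mu l.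
Proof.
move=> e; apply: eq_bigl => w; case: (boolP (fix_hi l w)) => hw; rewrite ?andbF // !andbT.
apply: eq_forallb => k; case: (ltnP k l) => hk; first by rewrite e // (fix_hi_lt l).
by rewrite (fix_hi_ge l w) // !eqxx.
Qed.

Lemma eq_Whi lam mu l :
  (forall k m, (l <= k)%N -> (l <= m)%N -> (lam k == lam m) = (mu k == mu m)) ->
  Whi lam l = Whi mu l.
Proof.
move=> e; apply: eq_bigl => w; case: (boolP (fix_lo l w)) => hw; rewrite ?andbF // !andbT.
apply: eq_forallb => k; case: (ltnP k l) => hk; first by rewrite (fix_lo_lt l w) // !eqxx.
by rewrite e // leqNgt (fix_lo_ge l) // -leqNgt.
Qed.

End Poincare.

(** * Column order through counting functions *)

Section Columns.
Variable n : nat.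
Implicit Types (i j : 'I_n) (C E F : {set 'I_n}) (k m : nat).

(** Rowwise comparison of columns amounts to comparing these counts at every threshold, and an
    adjacent transposition can alter them at a single threshold only. *)
Definition cnt C m : nat := #|[set x in C | (x < m)%N]|.

Lemma nth_col_nat C k m : (k < #|C|)%N ->
  (nth 0 (col_nat C) k < m)%N = (k < cnt C m)%N.
Proof.
have srt : sorted <=%O (col_nat C) by apply: sort_sorted; apply: leq_total.
have sz : size (col_nat C) = #|C| by rewrite size_sort size_map -cardE.
have -> : cnt C m = count (< m)%O (col_nat C).
  have /seq.permP -> : perm_eq (col_nat C) [seq val x | x <- enum C] by rewrite perm_sort.
  rewrite /cnt count_map cardE -size_filter; congr size.
  by rewrite {2}/enum_mem -filter_predI; apply: eq_filter => x; rewrite !inE /= andbC.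
move=> hk; case: (ltnP k (count _ _)) => h.
  exact: (nth_count_lt 0%N srt h).
apply/negbTE; rewrite -leqNgt.
by apply: (nth_count_ge _ srt); rewrite sz h hk.
Qed.

Lemma cnt_le C m : (cnt C m <= #|C|)%N.
Proof. by apply: subset_leq_card; apply/subsetP => x; rewrite inE => /andP[]. Qed.

Lemma ss2_cnt F E m : (#|E| <= #|F|)%N -> ss2 F E -> (cnt E m <= cnt F m)%N.
Proof.
move=> hEF h; rewrite leqNgt; apply/negP => hlt.
(* The row of index [cnt F m] is the offending one: there [E] has an entry below [m] and [F] has
   not. *)
have hE : (cnt F m < #|E|)%N := leq_trans hlt (cnt_le E m).
have := h _ hE; rewrite leqNgt => /negP; apply.
have : (nth 0 (col_nat E) (cnt F m) < m)%N by rewrite nth_col_nat.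
have := nth_col_nat F (cnt F m) m (leq_trans hE hEF); rewrite ltnn => /negbT.
by rewrite -leqNgt => h1 h2; apply: leq_trans h1.
Qed.

Lemma cnt_ss2 F E : (#|E| <= #|F|)%N -> (forall m, (cnt E m <= cnt F m)%N) -> ss2 F E.
Proof.
(* The threshold used is the entry of [E] plus one. *)
move=> hEF h k hk; rewrite -ltnS nth_col_nat; last exact: leq_trans hk hEF.
by apply: leq_trans _ (h _); rewrite -nth_col_nat.
Qed.

Lemma cntS C i : cnt C i.+1 = (cnt C i + (i \in C))%N.
Proof.
case: (boolP (i \in C)) => hi.
  have -> : cnt C i.+1 = #|i |: [set x in C | (x < i)%N]|.
    congr #|pred_of_set _|; apply/setP => x; rewrite !inE ltnS leq_eqVlt -val_eqE.
    by case: (eqVneq (val x) i) => //= /val_inj ->; rewrite hi.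
  by rewrite cardsU1 !inE ltnn andbF addnC.
rewrite addn0; congr #|pred_of_set _|; apply/setP => x; rewrite !inE ltnS leq_eqVlt.
by case: (eqVneq (val x) i) => //= /val_inj ->; rewrite (negbTE hi).
Qed.

Lemma cnt_sact i j C m : j = i.+1 :> nat -> m != j -> cnt (sact i j C) m = cnt C m.
Proof.
move=> hij hm; rewrite /cnt -(card_imset _ (@perm_inj _ (tperm i j))).
congr #|pred_of_set _|; apply/setP => x.
rewrite -[x](tpermK i j) mem_imset; last exact: perm_inj.
rewrite !inE mem_sact tpermK; congr (_ && _).
by case: tpermP => [->|->|//]; rewrite ?hij; lia.
Qed.

Lemma cnt_sact_adj i j C : j = i.+1 :> nat ->
  (cnt (sact i j C) j + (i \in C) = cnt C j + (j \in C))%N.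
Proof.
move=> hij; rewrite hij !cntS cnt_sact ?hij ?neq_ltn ?ltnSn // mem_sact tpermL.
by rewrite addnAC.
Qed.

Lemma col_le_cnt E F m : col_le E F -> (cnt F m <= cnt E m)%N.
Proof.
by case=> hc h; apply: ss2_cnt; rewrite ?hc // => k hk; apply: h; rewrite hc.
Qed.

(** Replacing [i] by [j] would lower the count at threshold [j], against the order; this turns the
    order condition into one on membership. *)
Lemma col_le_sactl i j C : j = i.+1 :> nat -> col_le (sact i j C) C ->
  ~~ ((i \in C) && (j \notin C)).
Proof.
move=> hij /(col_le_cnt _ _ j); have := cnt_sact_adj i j C hij.
by case: (i \in C); case: (j \in C) => //=; lia.
Qed.

Lemma col_le_sactr i j C : j = i.+1 :> nat -> col_le C (sact i j C) ->
  ~~ ((i \notin C) && (j \in C)).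
Proof.
move=> hij /(col_le_cnt _ _ j); have := cnt_sact_adj i j C hij.
by case: (i \in C); case: (j \in C) => //=; lia.
Qed.

Lemma cnt_subset E F m : E \subset F -> (cnt E m <= cnt F m)%N.
Proof.
move=> h; apply: subset_leq_card; apply/subsetP => x; rewrite !inE => /andP[xE ->].
by rewrite (subsetP h).
Qed.

(** At the threshold [#|E|] the column [F] has [#|E|] entries, which must be all of [E]. *)
Lemma ss2_initial F E : (#|E| <= #|F|)%N -> E = [set x : 'I_n | (x < #|E|)%N] ->
  ss2 F E -> E \subset F.
Proof.
move=> hc hE /(ss2_cnt F E #|E| hc).
have memE x : (x \in E) = (x < #|E|)%N by rewrite {1}hE inE.
have -> : cnt E #|E| = #|E|.
  by congr #|pred_of_set _|; apply/setP => x; rewrite inE -memE andbb.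
move=> h; have : [set x in F | (x < #|E|)%N] == E.
  by rewrite eqEcard h andbT; apply/subsetP => x; rewrite inE memE => /andP[].
by move=> /eqP <-; apply/subsetP => x; rewrite inE => /andP[].
Qed.

End Columns.

(** * Two columns: base case, recursion, vanishing and integrality *)

Section TwoColumns.
Variable n : nat.
Local Notation hecke := {ffun 'S_n -> K}.
Implicit Types (w v y : 'S_n) (i j k : 'I_n) (h g : hecke).
Implicit Types (C E F : {set 'I_n}) (l m : nat).

(** The preimage of the first [l] positions has the same size as that set, so one inclusion is an
    equality. *)
Lemma stab_le l w : (forall k, (w k < l)%N -> (k < l)%N) -> stab (varpi l) w.
Proof.
move=> h; have /eqP e : [set k | (w k < l)%N] == [set k : 'I_n | (k < l)%N].
  rewrite eqEcard; apply/andP; split; first by apply/subsetP => k; rewrite !inE; apply: h.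
  rewrite -(card_imset [set k : 'I_n | (w k < l)%N] (@perm_inj _ w)); apply: subset_leq_card.
  apply/subsetP => k; rewrite inE => hk; apply/imsetP.
  by exists (w^-1%g k); rewrite ?inE permKV.
by apply/stabP => k; move/setP/(_ k): e; rewrite !inE.
Qed.

Lemma u_ge F k : (k < #|F|)%N -> (k <= u_ F k)%N.
Proof.
case: k => k hk /=; elim: k hk => // k IH hk hF.
have hk' : (k < n)%N by lia.
apply: leq_ltn_trans (IH hk' _) _; first by lia.
by apply: u_mono => //=; rewrite hF (ltn_trans _ hF).
Qed.

Lemma stab_u F E : E = [set x : 'I_n | (x < #|E|)%N] -> (#|E| <= #|F|)%N ->
  E \subset F -> stab (varpi #|E|) (u_ F).
Proof.
move=> hE hc sEF; apply: stab_le => k hk.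
have kF : (k < #|F|)%N by rewrite -u_mem (subsetP sEF) // hE inE.
exact: leq_ltn_trans (u_ge F k kF) hk.
Qed.

Lemma shape2 F E w : (#|E| <= #|F|)%N ->
  stab (shape [:: F; E]) w = stab (varpi #|F|) w && stab (varpi #|E|) w.
Proof.
move=> hc; apply/idP/andP => [/stab_eq h|[/stabP h1 /stabP h2]].
  by split; apply/stabP => k; have := h k; rewrite /shape /=; lia.
by apply/forallP => k; rewrite /shape /= h1 h2.
Qed.

(** If [E] lies in [F], then [u_ F] stabilizes the weight of [E], and the sum runs over the
    permutations stabilizing both weights. Otherwise a nonzero term would make an element of [E]
    outside [F] a value of [u_ F] on the first block. *)
Lemma gam_one_par F E : E = [set x : 'I_n | (x < #|E|)%N] -> (#|E| <= #|F|)%N ->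
  gam n F (one_par n #|E|) = Wpoly (shape [:: F; E]) * (E \subset F)%:R.
Proof.
move=> hE hc; rewrite /gam /chi; case: (boolP (E \subset F)) => sEF.
  rewrite mulr1 /Wpoly [RHS]big_mkcond /=; apply: eq_bigr => y _.
  rewrite ffunE shape2 // one_parE (stab_compl _ _ _ _ (stab_u _ _ hE hc sEF)).
  by case: (stab _ y); case: (stab _ y); rewrite /= ?mul1r ?mul0r.
rewrite mulr0 big1 // => y _; rewrite ffunE one_parE.
case: ifP => [/stabP hy|_]; last by rewrite mul0r.
case: (boolP (stab _ _)) => [/stabP hu|_]; last by rewrite mul0r.
case/subsetPn: sEF => x xE /negP []; pose k := (comp (u_ F) y)^-1%g x.
have kE : (k < #|E|)%N by rewrite -hu permKV; move: xE; rewrite {1}hE inE.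
have -> : x = u_ F (y k) by rewrite -compE permKV.
by rewrite u_mem hy (leq_trans kE).
Qed.

Lemma Psi_cons C (S : seq {set 'I_n}) : S <> [::] ->
  Psi (C :: S) = hmul (Tinv n (u_ C)) (dpart n #|C| C (Psi S)).
Proof. by case: S => // D S _; rewrite /Tinv hmulZl -decomp_dpart. Qed.

Lemma chi_Psi_cons C (S : seq {set 'I_n}) : S <> [::] ->
  chi n (Psi (C :: S)) = gam n C (Psi S).
Proof. by move=> hS; rewrite Psi_cons // chiM chi_Tinv mul1r. Qed.

Lemma psit2 F E : psit [:: F; E] = (Wpoly (shape [:: F; E]))^-1 * gam n F (PsiCol E).
Proof. by rewrite -[PsiCol E]/(Psi [:: E]) -chi_Psi_cons. Qed.

Lemma shape_sact i j F E (b c : bool) :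
  Wpoly (shape [:: if b then sact i j F else F; if c then sact i j E else E]) =
  Wpoly (shape [:: F; E]).
Proof.
apply: eq_Wpoly => w; apply: eq_forallb => k; rewrite /shape /=.
by case: b; case: c; rewrite ?card_sact.
Qed.

Lemma psit2_base F E : u_ E = 1%g -> (#|E| <= #|F|)%N ->
  psit [:: F; E] = (E \subset F)%:R.
Proof.
move=> hu hc; have hE := u1_col _ _ hu.
by rewrite psit2 PsiColE hu Tinv1 hmul1l gam_one_par // mulKf // Wpoly_neq0.
Qed.

(** In [Tbar], the generator yields the first term and the scalar 1 - t the second. *)
Lemma psit2_asc F E i j : j = i.+1 :> nat -> ~~ ((i \in E) && (j \notin E)) ->
  ~~ ((i \notin F) && (j \in F)) ->
  psit [:: F; E] = tt * psit [:: sact i j F; sact i j E]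
                   + (1 - tt) * psit [:: F; sact i j E].
Proof.
move=> hij hE hF; rewrite !psit2 (PsiCol_sact _ _ _ _ hij hE) gam_Tbar //.
rewrite (shape_sact i j F E true true) (shape_sact i j F E false true).
have [e|ne] := eqVneq (i \in F) (j \in F).
  by rewrite gam_lmul_id // (sact_id _ _ _ F) //; ring.
rewrite gam_lmul_asc; first (by ring); try by [].
all: by move: hF ne; case: (i \in F); case: (j \in F).
Qed.

(** If [F] moves, the t - 1 produced by the generator cancels the 1 - t in [Tbar]; if [F] is fixed,
    the coefficients t and 1 - t add up to 1. *)
Lemma psit2_desc F E i j : j = i.+1 :> nat -> ~~ ((i \in E) && (j \notin E)) ->
  ~~ ((i \in F) && (j \notin F)) -> psit [:: F; E] = psit [:: sact i j F; sact i j E].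
Proof.
move=> hij hE hF; rewrite !psit2 (PsiCol_sact _ _ _ _ hij hE) gam_Tbar //.
rewrite (shape_sact i j F E true true).
have [e|ne] := eqVneq (i \in F) (j \in F).
  by rewrite gam_lmul_id // (sact_id _ _ _ F) //; ring.
rewrite gam_lmul_desc; first (by ring); try by [].
all: by move: hF ne; case: (i \in F); case: (j \in F).
Qed.

(** Both recursions are packed into one induction on [E]. The predicate sees the columns, so that
    vanishing and integrality are both instances. *)
Lemma psit2_rec (P : {set 'I_n} -> {set 'I_n} -> K -> Prop) :
  (forall F E, E = [set x : 'I_n | (x < #|E|)%N] -> (#|E| <= #|F|)%N ->
     P F E (E \subset F)%:R) ->
  (forall F E i j x z, j = i.+1 :> nat -> i \notin E -> j \in E -> (#|E| <= #|F|)%N ->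
     P (sact i j F) (sact i j E) x -> P F (sact i j E) z ->
     P F E x /\ P F E (tt * x + (1 - tt) * z)) ->
  forall F E, (#|E| <= #|F|)%N -> P F E (psit [:: F; E]).
Proof.
move=> P0 PS F E; move: E F; apply: col_ind => [E hu F hc|E i j hij iE jE IH F hc].
  by rewrite psit2_base //; apply: P0 => //; apply: u1_col.
have hE : ~~ ((i \in E) && (j \notin E)) by rewrite (negbTE iE).
have [h1 h2] : P F E (psit [:: sact i j F; sact i j E]) /\
  P F E (tt * psit [:: sact i j F; sact i j E] + (1 - tt) * psit [:: F; sact i j E]).
  by apply: (PS F E i j) => //; apply: IH; rewrite !card_sact.
case: (boolP ((i \notin F) && (j \in F))) => hF; last by rewrite (psit2_asc F E i j).
by rewrite (psit2_desc F E i j) //; case/andP: hF => /negbTE ->.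
Qed.

(** A shortfall of [F] at [m] persists through the recursion: only counts at [j] change, and there
    the count of [E] rises by one and that of [F] by at most one. At the base it contradicts
    inclusion. *)
Lemma psit2_nss F E m : (#|E| <= #|F|)%N -> (cnt n F m < cnt n E m)%N -> psit [:: F; E] = 0.
Proof.
move=> hc; move: m; apply: (psit2_rec
  (fun F E x => forall m, (cnt n F m < cnt n E m)%N -> x = 0)) hc => {F E}.
  move=> F E _ _ m; case: (boolP (E \subset F)) => // h.
  by rewrite ltnNge cnt_subset.
move=> F E i j x z hij iE jE hc hx hz; suff h m : (cnt n F m < cnt n E m)%N -> x = 0 /\ z = 0.
  by split=> m /h [-> e]; rewrite ?e; ring.
have [->|nm] := eqVneq m j.
  have := cnt_sact_adj _ i j F hij; have := cnt_sact_adj _ i j E hij.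
  rewrite (negbTE iE) jE => eE eF hlt.
  by split; [apply: (hx j) | apply: (hz j)]; move: eE eF hlt;
    case: (i \in F); case: (j \in F); lia.
by move=> hlt; split; [apply: (hx m) | apply: (hz m)]; rewrite !cnt_sact.
Qed.

Lemma in_Zt0 : in_Zt 0.
Proof. by exists 0; rewrite rmorph0 rmorph0. Qed.

Lemma in_Zt1 : in_Zt 1.
Proof. by exists 1; rewrite rmorph1 rmorph1. Qed.

Lemma in_ZtD x z : in_Zt x -> in_Zt z -> in_Zt (x + z).
Proof. by move=> [p ->] [q ->]; exists (p + q); rewrite !rmorphD. Qed.

Lemma in_ZtM x z : in_Zt x -> in_Zt z -> in_Zt (x * z).
Proof. by move=> [p ->] [q ->]; exists (p * q); rewrite !rmorphM. Qed.

Lemma in_Zt_tt : in_Zt tt.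
Proof. by exists 'X; rewrite map_polyX. Qed.

Lemma in_Zt_1tt : in_Zt (1 - tt).
Proof. by exists (1 - 'X); rewrite rmorphB rmorph1 /= map_polyX rmorphB rmorph1. Qed.

Lemma in_Zt_psit2 F E : (#|E| <= #|F|)%N -> in_Zt (psit [:: F; E]).
Proof.
apply: (psit2_rec (fun _ _ x => in_Zt x)) => {F E}.
  by move=> F E _ _; case: (E \subset F); [exact: in_Zt1 | exact: in_Zt0].
move=> F E i j x z _ _ _ _ hx hz; split=> //.
apply: in_ZtD; apply: in_ZtM => //; [exact: in_Zt_tt | exact: in_Zt_1tt].
Qed.

End TwoColumns.

(** * Factorization over adjacent columns *)

Section Factorization.
Variable n : nat.
Local Notation hecke := {ffun 'S_n -> K}.
Implicit Types (w v y : 'S_n) (i j k : 'I_n) (h g x : hecke).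
Implicit Types (C D E F : {set 'I_n}) (S T : seq {set 'I_n}) (l m : nat).

Definition inv_hi l h : Prop :=
  forall i j, j = i.+1 :> nat -> (l <= i)%N -> rmul_s i j h = hsc tt h.

Lemma adj_hi l i j : j = i.+1 :> nat -> (l <= i)%N -> (i < l)%N = (j < l)%N.
Proof. by move=> hij hl; rewrite hij !ltnNge hl ltnW. Qed.

Lemma inv_hi_le l m h : (l <= m)%N -> inv_hi l h -> inv_hi m h.
Proof. by move=> lm hh i j hij hi; apply: hh => //; apply: leq_trans hi. Qed.

Lemma inv_hi_mul l x h : inv_hi l h -> inv_hi l (hmul x h).
Proof.
by move=> hh i j hij hi; rewrite rmul_s_hmul // -hmulA -rmul_s_hmul // hh // hmulZr.
Qed.

Lemma inv_hi_one_par l : inv_hi l (one_par n l).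
Proof.
move=> i j hij hi; apply/ffunP => w.
rewrite hscE rmul_sE // !one_parE stab_compr; last exact/stab_tperm/adj_hi.
by case: ifP => _; ring.
Qed.

Lemma inv_hi_dpart C h : inv_hi #|C| h -> inv_hi #|C| (dpart n #|C| C h).
Proof.
move=> hh i j hij hi; rewrite -dpart_rmul //; last exact: adj_hi.
by rewrite hh // dpartZ.
Qed.

(** All descents of [w] lie at or beyond [l]; stripping one leaves the lower positions alone and
    costs a factor t. *)
Lemma inv_hi_T l g w : inv_hi l g -> stab (varpi l) w ->
  (forall i j, j = i.+1 :> nat -> (j < l)%N -> (w i < w j)%N) ->
  hmul g (T_ w) = hsc (tt ^+ len w) g.
Proof.
move=> hg; have [d] := ubnP (len w); elim: d w => // d IH w hd hw hlo.
case: (descentP _ w) => [->|[i [j [hij hij']]]].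
  by rewrite hmul1r len1 hsc1.
have li : (l <= i)%N.
  rewrite leqNgt; apply/negP => il.
  have jl : (j < l)%N by rewrite -(stab_desc _ _ _ _ _ hij hw hij').
  by have := hlo i j hij jl; rewrite ltnNge (ltnW hij').
have e := adj_hi _ _ _ hij li.
have hlen := len_desc _ _ _ _ hij hij'.
rewrite -{1}(compK _ i j w) -hmul_TT // ?compE ?tpermL ?tpermR //.
rewrite hmulA IH.
- by rewrite hmulZl -rmul_s_hmul // hg // hscA hlen -exprSr.
- by move: hd; rewrite hlen.
- by rewrite stab_compr // stab_tperm.
move=> a b hab hb; rewrite !compE.
have tl (c : 'I_n) : (c < l)%N -> tperm i j c = c.
  move=> hc; apply: tpermD; apply/eqP => ec; move: hc; rewrite -ec ?hij; lia.
by rewrite !tl ?hlo //; lia.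
Qed.

(** Descents below [l] are stripped first: they lie in the first block of [C], so [gam] absorbs each
    with a factor t. When none is left, [inv_hi_T] applies. *)
Lemma gam_mul_par C l x g w : (l <= #|C|)%N -> inv_hi l g -> stab (varpi l) w ->
  gam n C (hmul x (hmul g (T_ w))) = tt ^+ len w * gam n C (hmul x g).
Proof.
move=> hl hg; have [d] := ubnP (len w); elim: d w => // d IH w hd hw.
case: (boolP [exists p : 'I_n * 'I_n,
  [&& val p.2 == (val p.1).+1, (p.2 < l)%N & (w p.2 < w p.1)%N]]).
  case/existsP => -[i j] /= /and3P[/eqP hij jl hij'].
  have hlen := len_desc _ _ _ _ hij hij'.
  rewrite -{1}(compK _ i j w) -hmul_TT // ?compE ?tpermL ?tpermR //.
  rewrite !hmulA -rmul_s_hmul // gam_rmul //; last first.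
    by rewrite !(leq_trans _ hl) //; lia.
  rewrite -hmulA IH ?hlen ?exprS ?mulrA //.
    by move: hd; rewrite hlen.
  by rewrite stab_compr // stab_tperm // jl; lia.
rewrite negb_exists => /forallP h.
rewrite (inv_hi_T l) // ?hmulZr ?gamZ // => i j hij jl.
have := h (i, j); rewrite /= hij eqxx /= -hij jl /= -leqNgt => hw'.
by rewrite ltn_neqAle hw' perm_adj_neq.
Qed.

(* Both sides compute gam C (x * g * 1_l): g acts on 1_l by its character on
   the left, while on the right T_w is absorbed by C (low part) or by g (high part). *)
Lemma gam_factor C l x g : (l <= #|C|)%N -> inHpar l g -> inv_hi l g ->
  Wpoly (@varpi n l) * gam n C (hmul x g) = chi n g * gam n C (hmul x (one_par n l)).
Proof.
move=> hl hp hg; rewrite -[RHS]gamZ -hmulZr -par_one_par //.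
rewrite /one_par (hlin_sum n (hmul g)); last exact: hmul_linr.
rewrite (hlin_sum n (hmul x)); last exact: hmul_linr.
by rewrite gam_sum mulr_suml; apply: eq_bigr => w hw; rewrite (gam_mul_par C l).
Qed.

(** For nonempty [S] the second factor is a component of [Psi S]. By induction [Psi S] is invariant
    beyond the length of its first column, hence beyond [#|D|], and taking the component preserves
    this. *)
Lemma Psi_factor D S : all (fun C : {set 'I_n} => #|C| <= #|D|)%N S ->
  sorted geq [seq #|C| | C : {set 'I_n} <- S] ->
  exists g, [/\ Psi (D :: S) = hmul (Tinv n (u_ D)) g, inHpar #|D| g & inv_hi #|D| g].
Proof.
elim: S D => [|E S IH] D /=.
  move=> _ _; exists (one_par n #|D|); split; [exact: PsiColE | | exact: inv_hi_one_par].
  by move=> w; rewrite one_parE; case: (stab _ w) => //; rewrite eqxx.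
move=> /andP[ED hS] srt.
have tr : transitive geq by move=> a b c /= h1 h2; apply: leq_trans h1.
have hE : all (fun C : {set 'I_n} => #|C| <= #|E|)%N S.
  by move: srt; rewrite path_sortedE // all_map => /andP[].
have [g [e1 e2 e3]] := IH E hE (path_sorted srt).
exists (dpart n #|D| D (Psi (E :: S))); split.
- exact: (Psi_cons n D (E :: S)).
- exact: dpart_par.
apply: inv_hi_dpart; apply: inv_hi_le ED _.
by rewrite e1; apply: inv_hi_mul.
Qed.

(** All stabilizers are cut at [#|D|]. Below the cut [C] and [D] are full, so [[:: C; D]] behaves
    like [varpi]; beyond it [D] and [S] contribute nothing, so [D :: S] does. *)
Lemma Wpoly_factor C D S : (0 < #|D|)%N -> (#|D| <= #|C|)%N ->
  all (fun E : {set 'I_n} => #|E| <= #|D|)%N S ->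
  Wpoly (shape (D :: S)) * Wpoly (shape [:: C; D]) =
  Wpoly (shape [:: C, D & S]) * Wpoly (@varpi n #|D|).
Proof.
move=> D0 DC /allP hS.
have S0 k : (#|D| <= k)%N -> count (fun E : {set 'I_n} => (k < #|E|)%N) S = 0.
  move=> hk; apply/eqP; rewrite -leqn0 leqNgt -has_count; apply/hasPn => E /hS hE.
  by rewrite -leqNgt (leq_trans hE).
rewrite (Wpoly_split n (shape (D :: S)) #|D|); last first.
  by move=> k m hk hm; rewrite /shape /= (S0 m) // hk [(m < #|D|)%N]ltnNge hm.
rewrite (Wpoly_split n (shape [:: C; D]) #|D|); last first.
  move=> k m hk hm; rewrite /shape /= (leq_trans hk DC) hk [(m < #|D|)%N]ltnNge hm.
  by case: (m < _)%N.
rewrite (Wpoly_split n (shape [:: C, D & S]) #|D|); last first.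
  move=> k m hk hm; rewrite /shape /= (S0 m) // (leq_trans hk DC) hk.
  by rewrite [(m < #|D|)%N]ltnNge hm; case: (m < _)%N.
rewrite (Wpoly_split n (varpi #|D|) #|D|); last first.
  by move=> k m hk hm; rewrite /varpi hk ltnNge hm.
rewrite (eq_Wlo n (shape (D :: S)) (shape [:: C, D & S])); last first.
  by move=> k m hk hm; rewrite /shape /= (leq_trans hk DC) (leq_trans hm DC) eqn_add2l.
rewrite (eq_Whi n (shape (D :: S)) (varpi #|D|)); last first.
  by move=> k m hk hm; rewrite /shape /varpi /= !S0 // !addn0.
rewrite (eq_Wlo n (shape [:: C; D]) (varpi #|D|)); last first.
  by move=> k m hk hm; rewrite /shape /varpi /= (leq_trans hk DC) (leq_trans hm DC) hk hm.
rewrite (eq_Whi n (shape [:: C; D]) (shape [:: C, D & S])); last first.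
  by move=> k m hk hm; rewrite /shape /= !S0.
ring.
Qed.

Lemma psit1 C : psit [:: C] = 1.
Proof.
rewrite /psit -/(chi n _) [Psi _]PsiColE chiM chi_Tinv mul1r chi_one_par.
rewrite (eq_Wpoly n (shape [:: C]) (varpi #|C|)); first by rewrite mulVf ?Wpoly_neq0.
by move=> w; apply: eq_forallb => k; rewrite /shape /varpi /= !addn0.
Qed.

Lemma psit_cons C D S : (0 < #|D|)%N ->
  sorted geq [seq #|E| | E : {set 'I_n} <- [:: C, D & S]] ->
  psit [:: C, D & S] = psit [:: C; D] * psit (D :: S).
Proof.
move=> D0 /= /andP[DC srt].
have tr : transitive geq by move=> a b c /= h1 h2; apply: leq_trans h1.
have hS : all (fun E : {set 'I_n} => #|E| <= #|D|)%N S.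
  by move: srt; rewrite path_sortedE // all_map => /andP[].
have [g [e1 e2 e3]] := Psi_factor D S hS (path_sorted srt).
have hW := Wpoly_factor C D S D0 DC hS.
have hg := gam_factor C #|D| (Tinv n (u_ D)) g DC e2 e3.
rewrite psit2 /psit -!/(chi n _) chi_Psi_cons // e1 chiM chi_Tinv mul1r PsiColE.
(* Both [hg] and [hW] bring in [Wpoly (varpi #|D|)], which cancels at the end. *)
rewrite mulrACA -invfM [X in _ = _ * X]mulrC -hg [X in _ = X^-1 * _]mulrC hW invfM -mulrA.
by rewrite (mulKf (Wpoly_neq0 n (varpi #|D|))).
Qed.

Lemma psit_prod T : tensor_ok T ->
  psit T = \prod_(k < (size T).-1) psit [:: nth set0 T k; nth set0 T k.+1].
Proof.
case=> ne hpos srt; case: T ne hpos srt => // C S _.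
(* A single column corresponds to the empty product. *)
elim: S C => [|D S IH] C hpos srt; first by rewrite big_ord0 psit1.
have D0 : (0 < #|D|)%N by case/and3P: hpos.
rewrite psit_cons // big_ord_recl; congr (_ * _).
by apply: IH; [case/andP: hpos | move: srt => /= /andP[]].
Qed.

Lemma in_Zt_psit T : tensor_ok T -> in_Zt (psit T).
Proof.
move=> ok; rewrite psit_prod //; case: ok => _ _ srt.
apply: big_ind => [|a b|k _]; [exact: in_Zt1 | exact: in_ZtM |].
apply: in_Zt_psit2.
have hk : (k.+1 < size T)%N by have := ltn_ord k; lia.
move/sortedP: srt => /(_ 0%N k); rewrite size_map => /(_ hk).
by rewrite !(nth_map set0) // ltnW.
Qed.

End Factorization.

Theorem theorem7p1 (n : nat) (hn : (1 <= n)%N) :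
  (* (1) *)
  (forall T : seq {set 'I_n}, tensor_ok T ->
     psit T = \prod_(k < (size T).-1) psit [:: nth set0 T k; nth set0 T k.+1])
  /\
  (* (2) *)
  (forall (a b : nat) (F E : {set 'I_n}),
     (1 <= a)%N -> (a <= b)%N -> #|F| = b -> #|E| = a ->
     [/\ (* (a) *) ~ ss2 F E -> psit [:: F; E] = 0,
         (* (b) *) E = [set x : 'I_n | (x < a)%N] -> ss2 F E -> psit [:: F; E] = 1 &
         (* (c) *) forall i j : 'I_n, val j = (val i).+1 -> ss2 F E ->
            col_le (sact i j E) E ->
            (col_le F (sact i j F) ->
               psit [:: F; E] = tt * psit [:: sact i j F; sact i j E]
                                + (1 - tt) * psit [:: F; sact i j E])
            /\ (col_le (sact i j F) F ->
               psit [:: F; E] = psit [:: sact i j F; sact i j E])])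
  /\
  (* every psit T lies in Z[t] *)
  (forall T : seq {set 'I_n}, tensor_ok T -> in_Zt (psit T)).
Proof.
split; first exact: psit_prod.
split; last exact: in_Zt_psit.
move=> a b F E _ hab hF hE.
have hc : (#|E| <= #|F|)%N by rewrite hF hE.
split.
(* By contraposition: a nonzero value forces the count inequality at every threshold. *)
- move=> nss; apply/eqP; apply/negPn/negP => hpsi; apply: nss; apply: cnt_ss2 => // m.
  by rewrite leqNgt; apply: contra hpsi => h; rewrite (psit2_nss _ _ _ m).
- rewrite -hE => eE ss.
  have hu : u_ E = 1%g.
    apply: u_unique => [k|k m _]; rewrite !perm1 //.
    by rewrite {1}eE inE.
  by rewrite psit2_base // ss2_initial.
move=> i j hij _ hEs; have hE' := col_le_sactl _ _ _ _ hij hEs.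
split=> hFs.
  by apply: psit2_asc => //; apply: col_le_sactr.
by apply: psit2_desc => //; apply: col_le_sactl.
Qed.
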